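(* Let $-1<\alpha<0<\beta<1$, let $\sigma$ be a finite nonnegative measure (with infinite support) on $E=[-1,\alpha]\cup[\beta,1]$, let \[ \mathfrak F(\lambda)=\int_E\frac{t\,d\sigma(t)}{t-\lambda}, \] let $\{\widehat P_j\}_{j=0}^\infty$ be the monic polynomials orthogonal with respect to $\sigma$ ($\deg\widehat P_j=j$), and let $\mathcal N=\{n\in\mathbb N:\widehat P_{n-1}(0)\neq0\}$. Then: (i) The sequence of diagonal Padé approximants $\{\mathfrak F^{[n-1/n-1]}\}_{n\in\mathcal N}$ converges to $\mathfrak F$ locally uniformly in $\mathbb C\setminus((-\infty,\alpha]\cup[\beta,\infty))$. (ii) The sequence $\{\mathfrak F^{[n-1/n-1]}\}_{n\in\mathcal N}$ converges to $\mathfrak F$ locally uniformly in $\overline{\mathbb C}\setminus([-1-\varepsilon,\alpha]\cup[\beta,1+\varepsilon])$ for some $\varepsilon>0$ if and only if \[ \sup_{n\in\mathcal N}\left|\frac{\widehat P_n(0)}{\widehat P_{n-1}(0)}\right|<\infty . \]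
   Context: Here $\overline{\mathbb C}=\mathbb C\cup\{\infty\}$. Write $\mathfrak F(\lambda)=-\sum_{j\ge0}\mathfrak s_j\lambda^{-j-1}$ near $\infty$. The diagonal Padé approximant $\mathfrak F^{[m/m]}(\lambda)=A(1/\lambda)/B(1/\lambda)$ is a ratio of polynomials with $\deg A,\deg B\le m$, $B(0)\ne0$, and $\sum_{j=0}^{2m-1}\mathfrak s_j\lambda^{-j-1}+\mathfrak F^{[m/m]}(\lambda)=O(\lambda^{-2m-1})$ as $\lambda\to\infty$. (For $n\in\mathcal N$ the approximant $\mathfrak F^{[n-1/n-1]}$ exists.) *)

(* Defs.v *)
From HB Require Import structures.
From mathcomp Require Import all_boot all_order all_algebra.
From mathcomp Require Import all_classical all_reals all_analysis.
From mathcomp.real_closed Require Import complex.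

Set Implicit Arguments.
Unset Strict Implicit.
Unset Printing Implicit Defensive.

Import Order.TTheory GRing.Theory Num.Theory.
Import numFieldNormedType.Exports.

Local Open Scope classical_set_scope.
Local Open Scope complex_scope.
Local Open Scope ring_scope.

(* The topology of R[i] is the one given by its norm `|_|. *)
HB.instance Definition _ (R : realType) := NormedModule.copy R[i] R[i]^o.

(* The Riemann sphere; its point at infinity is [None]. *)
Notation sphere R := (one_point_compactification (complex R)).

Definition real_pts (R : realType) (A : set R) : set (sphere R) :=
  [set (Some x%:C : sphere R) | x in A].

Definition cintegral (R : realType) (mu : {measure set (measurableTypeR R) -> \bar R})
    (D : set R) (f : R -> R[i]) : R[i] :=
  (\int[mu]_(t in D) complex.Re (f t))%R +i* (\int[mu]_(t in D) complex.Im (f t))%R.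

Definition msupport (R : realType) (mu : {measure set (measurableTypeR R) -> \bar R}) :
    set R :=
  [set x : R | forall U : set R, open U -> U x -> (0 < mu U)%E].

Definition Fsigma (R : realType) (sigma : {measure set (measurableTypeR R) -> \bar R})
    (E : set R) (z : sphere R) : R[i] :=
  if z is Some l then cintegral sigma E (fun t => t%:C / (t%:C - l)) else 0.

Definition monic_orthogonal (R : realType)
    (sigma : {measure set (measurableTypeR R) -> \bar R}) (E : set R)
    (P : nat -> {poly R}) : Prop :=
  (forall j, P j \is monic /\ size (P j) = j.+1) /\
  (forall i j, i <> j ->
     (\int[sigma]_(t in E) ((P i).[t] * (P j).[t]))%R = 0).

(* F(l) = - \sum_(j >= 0) s_j l^(-j-1) near infinity *)
Definition expansion_at_infty (R : realType) (F : sphere R -> R[i])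
    (s : nat -> R[i]) : Prop :=
  exists M : R, forall l : R[i], M%:C < `|l| ->
    series (fun j => s j * l ^- j.+1) @ \oo --> - F (Some l).

Definition pade_pair (R : realType) (F : sphere R -> R[i]) (m : nat)
    (A B : {poly R[i]}) : Prop :=
  exists s : nat -> R[i],
    [/\ expansion_at_infty F s,
        (size A <= m.+1)%N, (size B <= m.+1)%N, B.[0] != 0 &
        exists K M : R, forall l : R[i], M%:C < `|l| ->
          `|\sum_(j < 2 * m) s j * l ^- j.+1 + A.[l^-1] / B.[l^-1]|
            <= K%:C * `|l| ^- (2 * m).+1].

(* The rational function p / q as a map of the sphere to itself: common factors
   are cancelled, and poles are sent to infinity. *)
Definition ratfun (R : realType) (p q : {poly R[i]}) (z : sphere R) :
    sphere R :=
  let p1 := p %/ gcdp p q in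
  let q1 := q %/ gcdp p q in
  match z with
  | Some l => if q1.[l] == 0 then None else Some (p1.[l] / q1.[l])
  | None => if (size q1 < size p1)%N then None
            else Some (p1`_(size q1).-1 / lead_coef q1)
  end.

(* l^m A(1/l), for size A <= m.+1 *)
Definition reverse_poly (R : realType) (m : nat) (A : {poly R[i]}) :
    {poly R[i]} := \poly_(i < m.+1) A`_(m - i).

(* A(1/l) / B(1/l) is written as l^m A(1/l) / (l^m B(1/l)), so that it also has
   a value at l = 0.  Two Pade pairs of the same order define the same map; the
   constant map infinity is the default when there is no Pade pair. *)
Definition pade (R : realType) (F : sphere R -> R[i]) (m : nat) :
    sphere R -> sphere R :=
  xget (fun=> None : sphere R)
    [set f : sphere R -> sphere R | exists A B : {poly R[i]},
       pade_pair F m A B /\ f = ratfun (reverse_poly m A) (reverse_poly m B)].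

(* Locally uniform convergence on D, along the indices in N, of sphere-valued
   maps to a finite-valued one: around each point of D, only finitely many of
   the maps may have poles. *)
Definition cvg_loc_unif (R : realType) (N : set nat)
    (f : nat -> sphere R -> sphere R) (g : sphere R -> R[i])
    (D : set (sphere R)) : Prop :=
  forall z, D z -> exists2 U : set (sphere R), nbhs z U &
    forall eps : R, 0 < eps ->
      \forall n \near \oo, N n -> forall w, D w -> U w ->
        exists2 v : R[i], f n w = Some v & `|v - g w| < eps%:C.

(* The natural numbers start at 1 here, P_(n-1) being involved. *)
Definition Nset (R : realType) (P : nat -> {poly R}) : set nat :=
  [set n | (0 < n)%N /\ (P n.-1).[0] != 0].

(* Main.v *)
Require Import Defs.
From mathcomp Require Import all_boot all_order all_algebra.
From mathcomp Require Import all_classical all_reals all_analysis.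
From mathcomp.real_closed Require Import complex.
From mathcomp Require Import ring lra zify measurable_realfun.
Set Implicit Arguments.
Unset Strict Implicit.
Unset Printing Implicit Defensive.
Import Order.TTheory GRing.Theory Num.Theory.
Import numFieldNormedType.Exports.
Import ComplexField.Normc.
Local Open Scope classical_set_scope.
Local Open Scope complex_scope.
Local Open Scope ring_scope.

(** Let [n = m + 1], [tau = P_n(0) / P_m(0)] and [Q = P_n - tau P_m]. Then
    [Q(0) = 0] and [Q] is orthogonal to every polynomial of degree less than [m],
    so no quadratic polynomial that is nonnegative on [E] can divide [Q] (the
    cofactor would be orthogonal to [Q]). Hence the zeros of [Q] are real and
    simple, and [0] is the only one in the gap between [alpha] and [beta]. They
    are the nodes of a quadrature rule with positive weights that is exact up to
    degree [2 m] ([gauss_quadrature]). The node [0] contributes nothing to the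
    quadrature sum of the kernel [t / (t - l)]; this sum is therefore a fraction
    of degree [m] in [1 / l], it agrees with [F] to order [2 m] at infinity by
    exactness, and so it is the Pade approximant ([pade_quadrature]). Everything
    is thus reduced to quadrature errors of the kernel.

    Off the two half-lines: one node may be far away, so that uniform polynomial
    approximation of the kernel on the set of all nodes is out of reach. But a
    negative power [t ^- k] can be approximated by a polynomial up to an error
    dominated by a nonnegative polynomial [G] whose integral is small, and the
    rule integrates [G] exactly, wherever its nodes are. So the moments in
    [u = 1 / t] converge ([inverse_moment_cvg]). In this variable the kernel is
    [1 / (1 - u l)] with [u] in a bounded interval. A disc that contains this
    interval but not [1 / l] gives a geometric expansion of the kernel in powers
    of [u - c], and with it locally uniform convergence
    ([quadrature_cauchy_cvg]).

    Near infinity: every node satisfies [|x| <= 1 + |tau|], by the extremal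
    property of [P_m]. If the ratios [tau] are bounded, all poles stay in a fixed
    disc, outside of which the kernel is expanded in powers of [t / l]
    ([quadrature_cauchy_cvg_infty]). Conversely, convergence near infinity keeps
    the poles in some disc of radius [r], and exactness for the polynomial
    ['X P_m^2 - Q P_m] of degree at most [2 m] yields [|tau| <= r + 1]. *)

(** * Splitting of real polynomials *)

Section RealRoots.
Context {R : realType}.
Implicit Types (p d : {poly R}) (x a b : R).

Lemma uniq_or_double_root (s : seq R) :
  uniq s \/ exists x, ('X - x%:P) ^+ 2 %| \prod_(y <- s) ('X - y%:P).
Proof.
elim: s => [|x s IH]; first by left.
have [xs|xs] := boolP (x \in s).
  right; exists x; rewrite big_cons expr2 dvdp_mul2l ?polyXsubC_eq0//.
  by rewrite dvdp_XsubCl root_prod_XsubC.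
case: IH => [us|[y hy]]; first by left; rewrite /= xs us.
by right; exists y; rewrite big_cons (dvdp_trans hy)// dvdp_mull.
Qed.

Lemma size_XsubC_mul a b : size (('X - a%:P) * ('X - b%:P)) = 3%N.
Proof. by rewrite size_mul ?polyXsubC_eq0// !size_XsubC. Qed.

(** The conjugate of [z] is another root, and divisibility by the product of the
    two linear factors descends from [R[i]] to [R]. *)
Lemma nonreal_root_quadratic p (z : R[i]) :
  root (map_poly (real_complex R) p) z -> complex.Im z != 0 ->
  ('X - (complex.Re z)%:P) ^+ 2 + ((complex.Im z) ^+ 2)%:P %| p.
Proof.
case: z => a b /= rz bn0.
have rz' : root (map_poly (real_complex R) p) (a -i* b).
  have := complex_root_conj (map_poly (real_complex R) p) (a +i* b).
  rewrite -map_poly_comp (@eq_map_poly _ _ _ (real_complex R)) ?rz //=.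
  by move=> x /=; rewrite oppr0.
rewrite -(dvdp_map (real_complex R)).
have -> : map_poly (real_complex R) (('X - a%:P) ^+ 2 + (b ^+ 2)%:P) =
   \prod_(y <- [:: (a +i* b); (a -i* b)]) ('X - y%:P).
  rewrite rmorphD rmorphXn rmorphB/= map_polyX !map_polyC/= !big_cons big_nil mulr1.
  have -> : (a +i* b)%:P = a%:C%:P + ('i * b%:C)%:P :> {poly R[i]}.
    by rewrite -polyCD; congr (_%:P); rewrite [LHS]complexE.
  have -> : (a -i* b)%:P = a%:C%:P - ('i * b%:C)%:P :> {poly R[i]}.
    by rewrite -polyCB; congr (_%:P); rewrite [LHS]complexE /= rmorphN mulrN.
  have -> : (b ^+ 2)%:C%:P = - ('i * b%:C)%:P ^+ 2 :> {poly R[i]}.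
    by rewrite -polyC_exp -polyCN exprMn sqr_i mulN1r opprK rmorphXn.
  ring.
apply: uniq_roots_dvdp; first by rewrite /= rz rz'.
rewrite uniq_rootsE/= inE andbT eq_complex/= eqxx/=.
by rewrite -subr_eq0 opprK -mulr2n mulrn_eq0.
Qed.

(** Nonnegative quadratic polynomials include the definite ones, whose absence as
    factors makes [p] split, and the squares, whose absence makes the roots
    simple. *)
Lemma monic_split p : p \is monic ->
  (forall d, size d = 3%N -> (forall t, 0 <= d.[t]) -> ~~ (d %| p)) ->
  exists2 s : seq R, uniq s & p = \prod_(x <- s) ('X - x%:P).
Proof.
move=> pm nod.
have [zs pzs] := closed_field_poly_normal (map_poly (real_complex R) p).
have pne : map_poly (real_complex R) p != 0 by rewrite map_poly_eq0 monic_neq0.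
rewrite lead_coef_map (monicP pm) rmorph1 scale1r in pzs.
have zreal z : z \in zs -> z = (complex.Re z)%:C.
  move=> zzs; have [iz|iz] := eqVneq (complex.Im z) 0.
    by rewrite [LHS]complexE iz rmorph0 mulr0 addr0.
  have rz : root (map_poly (real_complex R) p) z by rewrite pzs root_prod_XsubC.
  have := nonreal_root_quadratic rz iz; rewrite (negPf (nod _ _ _))//.
    rewrite size_polyDl expr2 size_XsubC_mul// (leq_ltn_trans (size_polyC_leq1 _))//.
  by move=> t; rewrite !hornerE addr_ge0// ?sqr_ge0.
have ps : p = \prod_(x <- [seq complex.Re z | z <- zs]) ('X - x%:P).
  apply: (map_poly_inj (real_complex R)); rewrite pzs rmorph_prod big_map/=.
  rewrite big_seq [RHS]big_seq; apply: eq_bigr => z /zreal zr.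
  by rewrite rmorphB/= map_polyX map_polyC/= -zr.
exists [seq complex.Re z | z <- zs] => //.
have [//|[x]] := uniq_or_double_root [seq complex.Re z | z <- zs].
rewrite -ps (negPf (nod _ _ _))//; first by rewrite expr2 size_XsubC_mul.
by move=> t; rewrite !hornerE sqr_ge0.
Qed.

End RealRoots.

(** * Quadrature at the zeros of a quasi-orthogonal polynomial *)

Definition quadrature {R : realType} (I : {poly R} -> R) (d : nat)
    (xs : seq R) (w : R -> R) : Prop :=
  [/\ uniq xs, forall x, x \in xs -> 0 < w x &
      forall h : {poly R}, (size h <= d.+1)%N ->
        I h = \sum_(x <- xs) w x * h.[x]].

Section Quadrature.
Context {R : realType} {alpha beta : R} {E : set R} {I : {poly R} -> R}.
Hypothesis alpha0 : alpha < 0.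
Hypothesis beta0 : 0 < beta.
Hypothesis E1 : forall t, E t -> -1 <= t <= 1.
Hypothesis Egap : forall t, E t -> t <= alpha \/ beta <= t.
Hypothesis linI : scalar I.
Hypothesis posI :
  forall p : {poly R}, p != 0 -> (forall t, E t -> 0 <= p.[t]) -> 0 < I p.

Let I0 : I 0 = 0.
Proof. by have := linI (-1) 0 0; rewrite scaler0 addr0 mulN1r addNr. Qed.

Let IZ a p : I (a *: p) = a * I p.
Proof. by have := linI a p 0; rewrite !addr0 I0 addr0. Qed.

Let ID p q : I (p + q) = I p + I q.
Proof. by have := linI 1 p q; rewrite scale1r mul1r. Qed.

Let IN p : I (- p) = - I p.
Proof. by rewrite -scaleN1r IZ mulN1r. Qed.

Let IB p q : I (p - q) = I p - I q. Proof. by rewrite ID IN. Qed.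

Let Isum (J : Type) (r : seq J) (F : J -> {poly R}) :
  I (\sum_(j <- r) F j) = \sum_(j <- r) I (F j).
Proof. exact: (big_morph I ID I0). Qed.

Context {P : nat -> {poly R}}.
Hypothesis Pmonic : forall j, P j \is monic.
Hypothesis Psize : forall j, size (P j) = j.+1.
Hypothesis Porth : forall i j, i <> j -> I (P i * P j) = 0.

Lemma nnegI (p : {poly R}) : (forall t, E t -> 0 <= p.[t]) -> 0 <= I p.
Proof.
have [->|p0 hp] := eqVneq p 0; first by rewrite I0.
exact/ltW/posI.
Qed.

Lemma sqr_mulX_bound (s : {poly R}) :
  - I (s ^+ 2) <= I ('X * s ^+ 2) <= I (s ^+ 2).
Proof.
have lc (c : R) : I ((c%:P + 'X) * s ^+ 2) = c * I (s ^+ 2) + I ('X * s ^+ 2).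
  by rewrite mulrDl ID mul_polyC IZ.
have sE (c : R) t : ((c%:P + 'X) * s ^+ 2).[t] = (c + t) * s.[t] ^+ 2.
  by rewrite hornerM horner_exp !hornerE.
have b1 : 0 <= I ((1%:P + 'X) * s ^+ 2).
  apply: nnegI => t /E1/andP[t1 _]; rewrite sE mulr_ge0 ?sqr_ge0//; lra.
have b2 : 0 <= - I (((-1)%:P + 'X) * s ^+ 2).
  rewrite -IN; apply: nnegI => t /E1/andP[_ t1].
  rewrite hornerN sE -mulNr mulr_ge0 ?sqr_ge0//; lra.
by rewrite !lc in b1 b2; apply/andP; split; lra.
Qed.

Lemma size_sub_monic n (p q : {poly R}) : p \is monic -> q \is monic ->
  size p = n.+1 -> size q = n.+1 -> (size (p - q)%R <= n)%N.
Proof.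
move=> pm qm ps qs; rewrite leqNgt; apply/negP => h.
have h0 : (p - q)`_n = 0.
  move/monicP: pm; move/monicP: qm; rewrite !lead_coefE ps qs /= => q1 p1.
  by rewrite coefB q1 p1 subrr.
have sz : size (p - q) = n.+1.
  apply/eqP; rewrite eqn_leq h andbT (leq_trans (size_polyD _ _))//.
  by rewrite size_polyN ps qs maxnn.
have /eqP h1 : p - q == 0 by rewrite -lead_coef_eq0 lead_coefE sz h0.
by move: sz; rewrite h1 size_poly0.
Qed.

Lemma orth_low n (g : {poly R}) : (size g <= n)%N -> I (P n * g) = 0.
Proof.
suff H k : (k <= n)%N -> forall g : {poly R}, (size g <= k)%N -> I (P n * g) = 0 by exact: H.
elim: k => [|k IH] kn {}g gk.
  by move: gk; rewrite leqn0 size_poly_eq0 => /eqP->; rewrite mulr0 I0.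
pose c := g`_k.
have -> : g = c *: P k + (g - c *: P k) by rewrite addrC subrK.
rewrite mulrDr -scalerAr ID IZ Porth; last by move=> e; rewrite e ltnn in kn.
rewrite mulr0 add0r; apply: IH; first exact: ltnW.
apply/leq_sizeP => j; rewrite leq_eqVlt => /orP[/eqP<-|kj].
  rewrite coefB coefZ /c; move/monicP: (Pmonic k); rewrite lead_coefE Psize /= => ->.
  by rewrite mulr1 subrr.
rewrite coefB coefZ (nth_default 0 (s := P k)) ?Psize// mulr0 subr0.
by rewrite nth_default// (leq_trans gk).
Qed.

Section Fixed.
Variable m : nat.
Hypothesis Pm0 : (P m).[0] != 0.

Let tau := (P m.+1).[0] / (P m).[0].
Let Q := P m.+1 - tau *: P m.

Let Qsize : size Q = m.+2.
Proof.
rewrite size_polyDl Psize// size_polyN.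
by rewrite (leq_ltn_trans (size_scale_leq _ _))// Psize.
Qed.

Let Qmonic : Q \is monic.
Proof.
apply/monicP; rewrite lead_coefDl ?(monicP _)//.
by rewrite size_polyN Psize (leq_ltn_trans (size_scale_leq _ _))// Psize.
Qed.

Let Q0 : Q != 0. Proof. exact: monic_neq0. Qed.

Let Qroot0 : root Q 0.
Proof. by rewrite /root /Q !hornerE /tau divfK// subrr. Qed.

Let Qorth (g : {poly R}) : (size g <= m)%N -> I (Q * g) = 0.
Proof.
move=> gm; rewrite /Q mulrBl IB -scalerAl IZ.
by rewrite !orth_low// ?(leq_trans gm)// mulr0 subr0.
Qed.

(** If [Q = d s], then [s] has degree less than [m], hence [I (d s^2) = 0]. That
    the zeros of [Q] are real, simple and, except for [0], outside the gap follows
    by choosing [d]. *)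
Let no_quadratic (d : {poly R}) : size d = 3%N -> (forall t, E t -> 0 <= d.[t]) -> ~~ (d %| Q).
Proof.
move=> d3 dE; apply/negP => /dvdpP[s Qs].
have s0 : s != 0 by apply: contraNneq Q0 => h; rewrite Qs h mul0r.
have d0 : d != 0 by rewrite -size_poly_eq0 d3.
have ss : (size s <= m)%N.
  have := Qsize; rewrite Qs size_mul// d3 addn3 /=.
  by move=> [->].
have : 0 < I (d * s ^+ 2).
  apply: posI; first by rewrite mulf_neq0// expf_neq0.
  by move=> t Et; rewrite hornerM horner_exp mulr_ge0// ?dE// sqr_ge0.
by rewrite expr2 mulrA (mulrC d) -Qs Qorth// ltxx.
Qed.

Let Qsplit : exists2 xs : seq R, uniq xs & Q = \prod_(x <- xs) ('X - x%:P).
Proof. by apply: monic_split => // d d3 dp; apply: no_quadratic => // t _. Qed.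

Let gap_root x : root Q x -> [\/ x <= alpha, x = 0 | beta <= x].
Proof.
move=> rx; have [->|x0] := eqVneq x 0; first exact: Or32.
have [xa|xa] := leP x alpha; first exact: Or31.
have [xb|xb] := leP beta x; first exact: Or33.
exfalso.
apply: (negP (@no_quadratic (('X - x%:P) * ('X - 0%:P)) (size_XsubC_mul _ _) _)).
  move=> t /Egap[ta|tb]; rewrite !hornerE ?subr0.
    rewrite nmulr_lge0; first by rewrite subr_le0 (le_trans ta)// ltW.
    exact: le_lt_trans ta alpha0.
  by rewrite mulr_ge0// ?subr_ge0 ?(le_trans (ltW xb))// (le_trans (ltW beta0)).
have := @uniq_roots_dvdp _ Q [:: x; 0].
rewrite !big_cons big_nil mulr1; apply; first by rewrite /= rx Qroot0.
by rewrite uniq_rootsE /= inE x0.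
Qed.

(** The difference [s - P m] has degree less than [m], so it is orthogonal to
    [P m] and the square norms add. *)
Let extremal (s : {poly R}) : s \is monic -> size s = m.+1 ->
  I (P m * s) = I (P m ^+ 2) /\ I (P m ^+ 2) <= I (s ^+ 2).
Proof.
move=> sm ss; have L := size_sub_monic sm (Pmonic m) ss (Psize m).
set l := s - P m in L; have -> : s = P m + l by rewrite addrC subrK.
have PL := orth_low L.
split; first by rewrite mulrDr ID PL addr0 expr2.
rewrite sqrrD mulr2n !ID PL !addr0 lerDl nnegI//.
by move=> t _; rewrite horner_exp sqr_ge0.
Qed.

Let normP : 0 < I (P m ^+ 2).
Proof.
by apply: posI; [rewrite expf_neq0// monic_neq0|move=> t _; rewrite horner_exp sqr_ge0].
Qed.

Let Qcofactor x : root Q x -> exists s : {poly R},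
  [/\ Q = s * ('X - x%:P), s \is monic & size s = m.+1].
Proof.
move=> /factor_theorem[s Qs]; exists s.
have sm : s \is monic by rewrite -(monicMr _ (monicXsubC x)) -Qs.
split => //; have := Qsize; rewrite Qs size_Mmonic ?monicXsubC ?monic_neq0//.
by rewrite size_XsubC addn2 => -[].
Qed.

(** With [s = Q / ('X - x)] one has [I (Q s) = - tau I (P_m^2)], while [I (Q s)]
    is [I (('X - x) s^2)], of size at least [(|x| - 1) I (s^2)]. *)
Let root_bound x : root Q x -> `|x| <= 1 + `|tau|.
Proof.
move=> /Qcofactor[s [Qs sm ss]].
have [Ps Pmin] := extremal sm ss.
have e1 : I (Q * s) = - tau * I (P m ^+ 2).
  rewrite {1}/Q mulrBl IB -scalerAl IZ Ps.
  by rewrite orth_low ?ss// sub0r mulNr.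
have e2 : I (Q * s) = I ('X * s ^+ 2) - x * I (s ^+ 2).
  have -> : Q * s = 'X * s ^+ 2 - x *: s ^+ 2.
    rewrite Qs -mul_polyC; ring.
  by rewrite IB IZ.
have /andP[b1 b2] := sqr_mulX_bound s.
have n1 := normP.
have := ler_norm tau; have := ler_norm (- tau); rewrite normrN.
move: e1; rewrite e2 => {e2} e1 ta tb.
move: (I _) (I ('X * _)) (I (s ^+ 2)) Pmin b1 b2 n1 e1 => h k l Pmin b1 b2 n1 e1.
rewrite ler_norml; apply/andP; split; nra.
Qed.

Let size_h_div (h : {poly R}) : (size h <= (2 * m).+1)%N -> (size (h %/ Q)%R <= m)%N.
Proof.
by move=> hs; rewrite size_divp// Qsize leq_subLR (leq_trans hs)// mul2n -addnn addSn.
Qed.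

(** The weights are the integrals of the Lagrange basis polynomials [l]; they are
    positive because exactness applies to the squares of these polynomials. The
    last two clauses relate the size of the nodes to [tau]. *)
Theorem gauss_quadrature : exists (xs : seq R) (w : R -> R),
  [/\ quadrature I (2 * m) xs w,
      size xs = m.+1 /\ 0 \in xs,
      forall x, x \in xs -> [\/ x <= alpha, x = 0 | beta <= x],
      forall x, x \in xs -> `|x| <= 1 + `|tau| &
      forall r : R, (forall x, x \in xs -> `|x| <= r) -> `|tau| <= r + 1].
Proof.
have [xs uxs Qxs] := Qsplit.
have rxs x : (x \in xs) = root Q x by rewrite Qxs root_prod_XsubC.
have szxs : size xs = m.+1.
  by have := Qsize; rewrite Qxs size_prod_XsubC => -[].
pose l x := (Q %/ ('X - x%:P)).[x]^-1 *: (Q %/ ('X - x%:P)).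
have lE x y : x \in xs -> y \in xs -> (l x).[y] = (x == y)%:R.
  move=> xxs yxs; have := xxs; rewrite rxs => /Qcofactor[s [Qs sm ss]].
  rewrite /l Qs mulpK ?polyXsubC_eq0// !hornerE.
  have [<-|xy] := eqVneq x y.
    rewrite mulVf//; apply/negP => /eqP sx.
    have : ('X - x%:P) ^+ 2 %| Q.
      by rewrite Qs expr2 dvdp_mul2r ?polyXsubC_eq0// dvdp_XsubCl /root sx.
    apply/negP/no_quadratic; first by rewrite expr2 size_XsubC_mul.
    by move=> t _; rewrite horner_exp sqr_ge0.
  have : Q.[y] == 0 by rewrite -[_ == 0]/(root Q y) -rxs.
  rewrite Qs !hornerE mulf_eq0 subr_eq0 (eq_sym y) (negPf xy) orbF => /eqP->.
  by rewrite mulr0.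
have lsize x : x \in xs -> (size (l x) <= m.+1)%N.
  rewrite rxs => /Qcofactor[s [Qs sm ss]].
  by rewrite (leq_trans (size_scale_leq _ _))// Qs mulpK ?polyXsubC_eq0// ss.
have exact_l (h : {poly R}) : (size h <= (2 * m).+1)%N ->
    I h = \sum_(x <- xs) I (l x) * h.[x].
  move=> hs; pose r : {poly R} := h %% Q.
  have hr x : x \in xs -> h.[x] = r.[x].
    by rewrite rxs => /eqP Qx; rewrite {1}(divp_eq h Q) hornerD hornerM Qx mulr0 add0r.
  have rs : (size r <= m.+1)%N by rewrite -ltnS -Qsize ltn_modp.
  have -> : I h = I r.
    rewrite {1}(divp_eq h Q) ID mulrC Qorth ?add0r// size_h_div//.
  have -> : r = \sum_(x <- xs) r.[x] *: l x.
    apply/eqP; rewrite -subr_eq0; apply/negPn/negP => D0.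
    have D1 : all (root (r - \sum_(x <- xs) r.[x] *: l x)) xs.
      apply/allP => y yxs; rewrite /root hornerD hornerN horner_sum.
      rewrite (bigD1_seq y)//= hornerZ lE// eqxx mulr1 big_seq_cond big1 ?addr0 ?subrr//.
      by move=> x /andP[xxs xy]; rewrite hornerZ lE// (negPf xy) mulr0.
    have := max_poly_roots D0 D1 uxs; rewrite szxs; apply/negP; rewrite -leqNgt.
    rewrite (leq_trans (size_polyD _ _))// geq_max rs size_polyN.
    apply: (leq_trans (size_sum _ _ _)); apply/bigmax_leqP_seq => x xxs _.
    by rewrite (leq_trans (size_scale_leq _ _))// lsize.
  rewrite Isum big_seq [RHS]big_seq; apply: eq_bigr => x xxs /=.
  by rewrite IZ mulrC -/r -hr.
have wpos x : x \in xs -> 0 < I (l x).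
  move=> xxs; have : I (l x ^+ 2) = I (l x).
    rewrite exact_l.
      rewrite (bigD1_seq x)//= horner_exp lE// eqxx expr1n mulr1.
      rewrite big_seq_cond big1 ?addr0// => y /andP[yxs yx].
      by rewrite horner_exp lE// eq_sym (negPf yx) expr0n mulr0.
    rewrite (leq_trans (size_poly_exp_leq _ _))//.
    by rewrite ltnS mulnC leq_pmul2l//; case: (size _) (lsize _ xxs).
  move=> <-; apply: posI; last by move=> t _; rewrite horner_exp sqr_ge0.
  rewrite expf_neq0//; apply/negP => /eqP l0.
  by have /eqP := lE _ _ xxs xxs; rewrite l0 horner0 eqxx eq_sym oner_eq0.
exists xs, (fun x => I (l x)); split => //.
- by rewrite rxs.
- by move=> x; rewrite rxs => /gap_root.
- by move=> x; rewrite rxs => /root_bound.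
move=> r xr.
(* [G] has the values of ['X P_m^2] at the nodes, but its degree is at most
   [2 m] since the leading terms cancel. *)
pose G := 'X * P m ^+ 2 - Q * P m.
have GE : G = P m * ('X * P m - Q) by rewrite /G; ring.
have Gs : (size G <= (2 * m).+1)%N.
  rewrite GE (leq_trans (size_polyMleq _ _))// Psize.
  have sX : size ('X * P m) = m.+2.
    by rewrite size_Mmonic ?polyX_eq0// size_polyX Psize.
  have mX : 'X * P m \is monic by rewrite monicMr ?monicX.
  by have := size_sub_monic mX Qmonic sX Qsize; move: (size _) => k; lia.
have IG : I G = I ('X * P m ^+ 2) + tau * I (P m ^+ 2).
  rewrite IB /Q mulrBl IB -scalerAl IZ -expr2.
  by rewrite orth_low ?Psize// sub0r opprK.
have Gx x : x \in xs -> G.[x] = x * (P m).[x] ^+ 2.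
  rewrite rxs => /eqP Qx; rewrite /G hornerD hornerN [(Q * _).[_]]hornerM Qx mul0r subr0.
  by rewrite hornerM horner_exp hornerX.
have LP : \sum_(x <- xs) I (l x) * (P m).[x] ^+ 2 = I (P m ^+ 2).
  rewrite exact_l; first by apply: eq_bigr => x _; rewrite horner_exp.
  by rewrite (leq_trans (size_poly_exp_leq _ _))// Psize /= mulnC.
have b1 : `|I G| <= r * I (P m ^+ 2).
  rewrite exact_l// -LP mulr_sumr (le_trans (ler_norm_sum _ _ _))//.
  rewrite big_seq [leRHS]big_seq; apply: ler_sum => x xxs.
  rewrite Gx// normrM (ger0_norm (ltW (wpos _ xxs))) normrM (ger0_norm (sqr_ge0 _)).
  rewrite mulrCA ler_wpM2r ?xr// mulr_ge0 ?sqr_ge0//; exact/ltW/wpos.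
have /andP[b2 b3] := sqr_mulX_bound (P m).
have n1 := normP.
move: b1; rewrite IG ler_norml => /andP[].
move: (I (P m ^+ 2)) (I ('X * _)) b2 b3 n1 => h k b2 b3 n1 c1 c2.
rewrite ler_norml; apply/andP; split; nra.
Qed.

End Fixed.

End Quadrature.

(** * The modulus of a complex number *)

Section Normc.
Context {R : realType}.
Implicit Types (z w : R[i]) (x : R).

Lemma normrE_normc z : `|z| = (normc z)%:C. Proof. by []. Qed.

Lemma normc_real x : normc x%:C = `|x|.
Proof. by rewrite /normc /= expr0n addr0 sqrtr_sqr. Qed.

Lemma normc_ge0 z : 0 <= normc z.
Proof. by rewrite -lecR -normrE_normc normr_ge0. Qed.

Lemma normcX z k : normc (z ^+ k) = normc z ^+ k.
Proof. by elim: k => [|k IH]; rewrite ?expr0 ?normc1// !exprS normcM IH. Qed.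

Lemma le_normc_sum (J : Type) (r : seq J) (F : J -> R[i]) :
  normc (\sum_(j <- r) F j) <= \sum_(j <- r) normc (F j).
Proof.
elim/big_rec2: _ => [|j y z _ h]; first by rewrite normc0.
by rewrite (le_trans (le_normcD _ _))// lerD2l.
Qed.

Lemma le_normcB z w : normc z - normc w <= normc (z - w).
Proof. by rewrite lerBlDr (le_trans _ (le_normcD _ _))// subrK. Qed.

Lemma normcBC z w : normc (z - w) = normc (w - z).
Proof. by rewrite -normcN opprB. Qed.

Lemma normc_eq0 z : (normc z == 0) = (z == 0).
Proof. by apply/eqP/eqP => [/eq0_normc|->]; rewrite ?normc0. Qed.

Lemma normc_gt0 z : (0 < normc z) = (z != 0).
Proof. by rewrite lt_def normc_ge0 andbT normc_eq0. Qed.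

Lemma ReD z w : complex.Re (z + w) = complex.Re z + complex.Re w.
Proof. by case: z; case: w. Qed.

Lemma ImD z w : complex.Im (z + w) = complex.Im z + complex.Im w.
Proof. by case: z; case: w. Qed.

Lemma normc_Re z : `|complex.Re z| <= normc z.
Proof. by case: z => a b; rewrite /normc/= -sqrtr_sqr ler_wsqrtr// lerDl sqr_ge0. Qed.

Lemma normc_Im z : `|complex.Im z| <= normc z.
Proof. by case: z => a b; rewrite /normc/= -sqrtr_sqr ler_wsqrtr// lerDr sqr_ge0. Qed.

Lemma normc_ReIm z : normc z <= `|complex.Re z| + `|complex.Im z|.
Proof.
rewrite [in leLHS](complexE z) (le_trans (le_normcD _ _))// normcM !normc_real.
by rewrite [normc 'i]/normc /= expr0n expr1n add0r sqrtr1 mul1r.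
Qed.

End Normc.

(** * Two elementary estimates *)

(** Bernoulli's inequality in a form valid for all nonnegative [y]: the second
    term takes over where [1 - y] may be large. *)
Lemma one_sub_exp_bound {R : realType} (y : R) k : 0 <= y ->
  `|1 - (1 - y) ^+ k.+1| <= k.+1%:R * y + 2 * y ^+ k.+1.
Proof.
move=> y0; have [y1|y1] := leP y 1.
  suff H j : `|1 - (1 - y) ^+ j| <= j%:R * y.
    by rewrite (le_trans (H _))// lerDl mulr_ge0// exprn_ge0.
  elim: j => [|j IH]; first by rewrite expr0 subrr normr0 mul0r.
  have -> : 1 - (1 - y) ^+ j.+1 = (1 - (1 - y) ^+ j) * (1 - y) + y.
    by rewrite exprS; ring.
  rewrite (le_trans (ler_normD _ _))// (ger0_norm y0).
  rewrite [leRHS](_ : _ = j%:R * y + y); last by rewrite -natr1; ring.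
  rewrite lerD2r normrM (le_trans _ IH)// ler_piMr//; rewrite ger0_norm; lra.
have h1 : `|(1 - y) ^+ k.+1| <= y ^+ k.+1.
  by rewrite normrX lerXn2r ?nnegrE//; rewrite ltr0_norm; lra.
have h2 : 1 <= y ^+ k.+1 by rewrite exprn_ege1// ltW.
have h3 : 0 <= k.+1%:R * y by rewrite mulr_ge0.
rewrite (le_trans (ler_normB _ _))// normr1; lra.
Qed.

Lemma geometric_small {R : realType} (k C e : R) : 0 <= k < 1 -> 0 <= C -> 0 < e ->
  exists N : nat, C * k ^+ N < e.
Proof.
move=> /andP[k0 k1] C0 e0.
have kn : `|k| < 1 by rewrite ger0_norm.
have /cvgrPdist_lt /(_ (e / (C + 1))) := cvg_expr kn.
have C1 : 0 < C + 1 by lra.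
rewrite divr_gt0// => /(_ isT)[N _ /(_ N (leqnn N))] /=.
rewrite sub0r normrN ger0_norm ?exprn_ge0// => h; exists N.
rewrite (@le_lt_trans _ _ ((C + 1) * k ^+ N))//.
  by rewrite ler_wpM2r ?exprn_ge0//; lra.
by rewrite mulrC -ltr_pdivlMr.
Qed.

(** * Integrals of complex functions over a compact set *)

Section Integrals.
Context {R : realType} {E : set R}.
Context {sigma : {finite_measure set (measurableTypeR R) -> \bar R}}.
Hypothesis compactE : compact E.

Let mE : measurable (E : set (measurableTypeR R)).
Proof. exact: compact_measurable. Qed.

Let sfin : (sigma E < +oo)%E.
Proof. by rewrite ltey_eq fin_num_measure. Qed.

Lemma total_mass_ge0 : 0 <= fine (sigma E).
Proof. by rewrite fine_ge0. Qed.

Lemma continuous_integrable (f : R -> R) :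
  (forall t, E t -> {for t, continuous f}) ->
  sigma.-integrable E (EFin \o f).
Proof.
move=> fc; have cf : {within E, continuous f}.
  by apply: continuous_in_subspaceT => t /set_mem /fc.
apply: measurable_bounded_integrable => //.
  by apply: subspace_continuous_measurable_fun.
have /compact_bounded[M [Mr hM]] := continuous_compact cf compactE.
by exists M; split=> // N MN t Et /=; apply: (hM N MN); exists t.
Qed.

Definition cintegrable (f : R -> R[i]) : Prop :=
  sigma.-integrable E (EFin \o (fun t => complex.Re (f t))) /\
  sigma.-integrable E (EFin \o (fun t => complex.Im (f t))).

Lemma integrable_addR (f g : R -> R) : sigma.-integrable E (EFin \o f) ->
  sigma.-integrable E (EFin \o g) ->
  sigma.-integrable E (EFin \o (fun t => f t + g t)).
Proof. by move=> hf hg; exact: (integrableD mE hf hg). Qed.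

Lemma integrable_scaleR (a : R) (f : R -> R) : sigma.-integrable E (EFin \o f) ->
  sigma.-integrable E (EFin \o (fun t => a * f t)).
Proof. by move=> hf; exact: (integrableZl mE a hf). Qed.

Lemma integrable_subR (f g : R -> R) : sigma.-integrable E (EFin \o f) ->
  sigma.-integrable E (EFin \o g) ->
  sigma.-integrable E (EFin \o (fun t => f t - g t)).
Proof. by move=> hf hg; exact: (integrableB mE hf hg). Qed.

Lemma cintegrable_real (f : R -> R) : sigma.-integrable E (EFin \o f) ->
  cintegrable (fun t => (f t)%:C).
Proof. by move=> hf; split => //=; exact: integrable0. Qed.

Lemma cintegrableD f g : cintegrable f -> cintegrable g ->
  cintegrable (fun t => f t + g t).
Proof.
move=> [f1 f2] [g1 g2]; split.
- by apply: eq_integrable (integrable_addR f1 g1) => // t _; rewrite /= ReD.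
- by apply: eq_integrable (integrable_addR f2 g2) => // t _; rewrite /= ImD.
Qed.

Lemma cintegrableZ (a : R[i]) f : cintegrable f ->
  cintegrable (fun t => a * f t).
Proof.
case: a => x y [f1 f2]; split.
- apply: eq_integrable (integrable_subR (integrable_scaleR x f1) (integrable_scaleR y f2)) => //.
  by move=> t _ /=; case: (f t).
- apply: eq_integrable (integrable_addR (integrable_scaleR x f2) (integrable_scaleR y f1)) => //.
  by move=> t _ /=; case: (f t).
Qed.

Lemma cintegral_real (f : R -> R) :
  cintegral sigma E (fun t => (f t)%:C) = (\int[sigma]_(t in E) f t)%:C.
Proof. by rewrite /cintegral /= /Rintegral integral0. Qed.

Lemma cintegralD f g : cintegrable f -> cintegrable g ->
  cintegral sigma E (fun t => f t + g t) =
  cintegral sigma E f + cintegral sigma E g.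
Proof.
move=> [f1 f2] [g1 g2]; apply/eqP; rewrite eq_complex /=; apply/andP; split; apply/eqP.
- by rewrite -RintegralD//; apply: eq_Rintegral => t _; rewrite ReD.
- by rewrite -RintegralD//; apply: eq_Rintegral => t _; rewrite ImD.
Qed.

Lemma cintegralZ (a : R[i]) f : cintegrable f ->
  cintegral sigma E (fun t => a * f t) = a * cintegral sigma E f.
Proof.
case: a => x y [f1 f2]; apply/eqP; rewrite eq_complex /=; apply/andP; split; apply/eqP.
- rewrite -!RintegralZl// -RintegralB//; try exact: integrable_scaleR.
  by apply: eq_Rintegral => t _; case: (f t).
- rewrite -!RintegralZl// -RintegralD//; try exact: integrable_scaleR.
  by apply: eq_Rintegral => t _; case: (f t).
Qed.

Lemma cintegrable_sum K (F : nat -> R -> R[i]) : (forall k, cintegrable (F k)) ->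
  cintegrable (fun t => \sum_(k < K) F k t).
Proof.
move=> hF; elim: K => [|K IH].
  under eq_fun do rewrite big_ord0.
  exact: (cintegrable_real (integrable0 _ _)).
under eq_fun do rewrite big_ord_recr /=.
exact: cintegrableD.
Qed.

Lemma cintegral_sum K (F : nat -> R -> R[i]) : (forall k, cintegrable (F k)) ->
  cintegral sigma E (fun t => \sum_(k < K) F k t) =
  \sum_(k < K) cintegral sigma E (F k).
Proof.
move=> hF; elim: K => [|K IH].
  rewrite big_ord0; under eq_fun do rewrite big_ord0.
  by rewrite (cintegral_real (fun=> 0)) Rintegral_cst// mul0r.
under eq_fun do rewrite big_ord_recr /=.
by rewrite big_ord_recr /= cintegralD ?IH//; exact: cintegrable_sum.
Qed.

Lemma Rintegral_bound (f : R -> R) e : sigma.-integrable E (EFin \o f) ->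
  (forall t, E t -> `|f t| <= e) ->
  `|\int[sigma]_(t in E) f t| <= e * fine (sigma E).
Proof.
move=> hf fe; rewrite (le_trans (le_normr_Rintegral _ _))// -Rintegral_cst//.
apply: le_Rintegral => //; first exact: integrable_norm.
exact: continuous_integrable (fun t _ => cvg_cst _).
Qed.

Lemma cintegral_bound f e : cintegrable f -> (forall t, E t -> normc (f t) <= e) ->
  normc (cintegral sigma E f) <= 2 * (e * fine (sigma E)).
Proof.
move=> [f1 f2] fe; rewrite (le_trans (normc_ReIm _))// mulr_natl mulr2n lerD//=.
- by apply: Rintegral_bound => // t Et; rewrite (le_trans (normc_Re _)) ?fe.
- by apply: Rintegral_bound => // t Et; rewrite (le_trans (normc_Im _)) ?fe.
Qed.

Lemma integrable_horner (p : {poly R}) : sigma.-integrable E (EFin \o (fun t => p.[t])).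
Proof. by apply: continuous_integrable => t _; exact: continuous_horner. Qed.

Lemma cintegrable_cauchy (l : R[i]) : (forall t, E t -> t%:C != l) ->
  cintegrable (fun t => t%:C / (t%:C - l)).
Proof.
case: l => a b lE.
have den t : E t -> (t - a) ^+ 2 + b ^+ 2 != 0.
  move=> /lE; rewrite eq_complex /= negb_and (eq_sym 0) -(subr_eq0 t) => h.
  rewrite paddr_eq0 ?sqr_ge0// !sqrf_eq0 negb_and; exact: h.
have c1 : forall t, {for t, continuous (fun t : R => (t - a) ^+ 2 + b ^+ 2)}.
  move=> t; apply: cvgD; last exact: cvg_cst.
  have h : (fun u : R => u - a) @ t --> t - a.
    by apply: cvgB; [exact: cvg_id|exact: cvg_cst].
  exact: (cvgM h h).
split.
- apply: (@eq_integrable _ _ _ _ _ mE (EFin \o (fun t => t * (t - a) / ((t - a) ^+ 2 + b ^+ 2)))).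
    move=> t _ /=; congr EFin; rewrite sub0r sqrrN; ring.
  apply: continuous_integrable => t Et; apply: cvgM; last by apply: cvgV (den _ Et) (c1 t).
  by apply: cvgM; [exact: cvg_id|apply: cvgB; [exact: cvg_id|exact: cvg_cst]].
- apply: (@eq_integrable _ _ _ _ _ mE (EFin \o (fun t => t * b / ((t - a) ^+ 2 + b ^+ 2)))).
    move=> t _ /=; congr EFin; rewrite sub0r sqrrN; ring.
  apply: continuous_integrable => t Et; apply: cvgM; last by apply: cvgV (den _ Et) (c1 t).
  by apply: cvgM; [exact: cvg_id|exact: cvg_cst].
Qed.

End Integrals.

(** * The moment functional *)

Section MomentFunctional.
Context {R : realType} {E : set R}.
Context {sigma : {finite_measure set (measurableTypeR R) -> \bar R}}.
Hypothesis compactE : compact E.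

Let mE : measurable (E : set (measurableTypeR R)).
Proof. exact: compact_measurable. Qed.

Definition moment (p : {poly R}) : R := (\int[sigma]_(t in E) p.[t])%R.

Lemma moment_linear : scalar moment.
Proof.
move=> a p q; rewrite /moment -RintegralZl//; last exact: integrable_horner.
rewrite -RintegralD//; last 2 first.
- by apply: integrable_scaleR => //; exact: integrable_horner.
- exact: integrable_horner.
by apply: eq_Rintegral => t _; rewrite hornerD hornerZ.
Qed.

(** A nonnegative integrand with zero integral vanishes almost everywhere, so the
    support would be contained in the finite set of roots of [p]. *)
Lemma moment_gt0 (p : {poly R}) : sigma (~` E) = 0%E ->
  infinite_set (msupport sigma) ->
  p != 0 -> (forall t, E t -> 0 <= p.[t]) -> 0 < moment p.
Proof.
move=> sE sinf p0 pE.
have ip := @integrable_horner _ _ sigma compactE p.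
have I0 : 0 <= moment p by exact: Rintegral_ge0.
rewrite lt_def I0 andbT; apply/eqP => Ip0.
have : (\int[sigma]_(t in E) `|(EFin \o (fun t => p.[t])) t| = 0)%E.
  rewrite -[RHS]/(0%:E) -Ip0 /moment /Rintegral fineK; last exact: integrable_fin_num.
  by apply: eq_integral => t /set_mem Et /=; rewrite ger0_norm// pE.
move/(ae_eq_integral_abs _ mE) => /(_ (measurable_int _ ip)) ae0.
have [x sx px] : exists2 x, msupport sigma x & p.[x] != 0.
  apply: contrapT => nx.
  have [B BA Bn] := infinite_set_fset (size p) sinf.
  suff rB : all (root p) (finmap.enum_fset B).
    by have := max_poly_roots p0 rB (finmap.fset_uniq B); rewrite ltnNge Bn.
  apply/allP => y yB; apply/negPn/negP => py; apply: nx; exists y => //.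
  exact: BA.
have oU : open [set t : R | p.[t] != 0].
  apply: (@open_comp _ _ (fun t => p.[t]) [set y | y != 0]).
    by move=> t _; exact: continuous_horner.
  exact: open_neq.
have := sx _ oU px; rewrite lt0e => /andP[/eqP + _]; apply.
apply/negligibleP; first exact: open_measurable.
have [N [mN N0 hN]] := ae0.
have nE : sigma.-negligible (~` E).
  by apply/negligibleP => //; exact: measurableC.
apply: (@negligibleS _ _ _ _ (N `|` ~` E)).
  move=> t /= pt; have [Et|] := pselect (E t); last by right.
  left; apply: hN => /= /(_ Et) [] /eqP; exact/negP.
apply: negligibleU => //; exists N; split=> //.
Qed.

End MomentFunctional.

(** * Convergence of quadrature sums of the Cauchy kernel *)

Section Convergence.
Context {R : realType} {alpha beta : R} {E : set R}.
Context {sigma : {finite_measure set (measurableTypeR R) -> \bar R}}.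
Hypothesis alpha0 : alpha < 0.
Hypothesis beta0 : 0 < beta.
Hypothesis alpha1 : -1 < alpha.
Hypothesis compactE : compact E.
Hypothesis E1 : forall t, E t -> -1 <= t <= 1.
Hypothesis Egap : forall t, E t -> t <= alpha \/ beta <= t.

Let mE : measurable (E : set (measurableTypeR R)).
Proof. exact: compact_measurable. Qed.

Let s0 : R := fine (sigma E).
Let I : {poly R} -> R := @moment R E sigma.

Let En0 t : E t -> t != 0.
Proof.
by move=> /Egap[h|h]; [rewrite lt_eqF// (le_lt_trans h)|rewrite gt_eqF// (lt_le_trans beta0)].
Qed.

Let s0_ge0 : 0 <= s0. Proof. exact: total_mass_ge0. Qed.

Definition outside_gap (xs : seq R) : Prop :=
  forall x, x \in xs -> [\/ x <= alpha, x = 0 | beta <= x].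

(** [t * t^-1 ^+ k.+1] is [t ^- k] away from [0] and vanishes at [0], so that the
    node [0] does not contribute. *)
Definition inverse_power (k : nat) (t : R) : R := t * t^-1 ^+ k.+1.

Lemma inverse_power_integrable k : sigma.-integrable E (EFin \o inverse_power k).
Proof.
apply: continuous_integrable => // t /En0 t0.
apply: cvgM; first exact: cvg_id.
have h : (fun u : R => u^-1) @ t --> t^-1 by apply: cvgV => //; exact: cvg_id.
elim: k.+1 => [|j IH]; first exact: cvg_cst.
by under eq_fun do rewrite exprS; rewrite exprS; exact: cvgM.
Qed.

Lemma sum_weights d xs w : quadrature I d xs w -> \sum_(x <- xs) w x = s0.
Proof.
move=> [_ _ /(_ 1)]; rewrite size_poly1 => /(_ isT) h.
under eq_bigr => x _ do rewrite -[w x]mulr1 -(hornerC 1 x).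
rewrite -h /I /moment; under eq_Rintegral do rewrite hornerC.
by rewrite Rintegral_cst// mul1r.
Qed.

(** Exactness on the majorant [G] turns a pointwise bound on the nodes, however
    far out they lie, into a bound by an integral over [E]. *)
Lemma quadrature_error_le d xs w (f : R -> R) (h G : {poly R}) :
  quadrature I d xs w -> (size h <= d.+1)%N -> (size G <= d.+1)%N ->
  sigma.-integrable E (EFin \o f) ->
  (forall t, t \in xs \/ E t -> `|f t - h.[t]| <= G.[t]) ->
  `|\sum_(x <- xs) w x * f x - (\int[sigma]_(t in E) f t)%R| <= 2 * I G.
Proof.
move=> [_ wpos ex] hd Gd fint fh.
have hint := @integrable_horner _ _ sigma compactE h.
have dint := integrable_subR compactE fint hint.
have -> : \sum_(x <- xs) w x * f x - (\int[sigma]_(t in E) f t)%R =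
    \sum_(x <- xs) w x * (f x - h.[x]) - (\int[sigma]_(t in E) (f t - h.[t]))%R.
  rewrite RintegralB// -/(moment h) -/I ex//.
  under [in RHS]eq_bigr do rewrite mulrBr.
  by rewrite big_split /= sumrN; ring.
rewrite mulr_natl mulr2n (le_trans (ler_normB _ _))// lerD//.
  rewrite (ex G)// (le_trans (ler_norm_sum _ _ _))// big_seq [leRHS]big_seq.
  apply: ler_sum => x xxs; rewrite normrM (gtr0_norm (wpos _ xxs)).
  by rewrite ler_pM2l ?wpos// fh//; left.
rewrite (le_trans (le_normr_Rintegral _ _))// le_Rintegral//.
- exact: integrable_norm.
- exact: integrable_horner.
- by move=> t Et; rewrite fh//; right.
Qed.

(** The polynomial approximation of [t ^- k] is [t ((1 - Y) / t) ^ (k + 1)], which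
    also vanishes at the node [0]. *)
Lemma inverse_moment_cvg k e : 0 < e -> exists d0, forall d xs w, (d0 <= d)%N ->
  quadrature I d xs w -> outside_gap xs ->
  `|\sum_(x <- xs) w x * inverse_power k x - (\int[sigma]_(t in E) inverse_power k t)%R| <= e.
Proof.
move=> e0; pose delta := Num.min (- alpha) beta.
have d0 : 0 < delta by rewrite lt_min beta0 oppr_gt0 alpha0.
have d1 : delta <= 1 by rewrite ge_min lerNl ltW.
have dS t : t <= alpha \/ beta <= t -> delta <= `|t|.
  case=> h; rewrite ge_min; apply/orP; [left|right].
    by rewrite ler0_norm ?lerN2// (le_trans h)// ltW.
  by rewrite ger0_norm// (le_trans _ h)// ltW.
pose kap := 1 - delta ^+ 2.
have kap01 : 0 <= kap < 1.
  rewrite /kap subr_ge0 expr_le1//; last exact: ltW.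
  by rewrite d1 /= ltrBlDr ltrDl exprn_gt0.
have /andP[kap0 kap1] := kap01.
pose C := delta^-1 ^+ k * (k.+1%:R + 2).
have C0 : 0 <= C by rewrite mulr_ge0 ?exprn_ge0 ?invr_ge0 ?(ltW d0)// addr_ge0.
have B0 : 0 <= 2 * (C * s0) by apply: mulr_ge0 => //; exact: mulr_ge0.
have [N hN] := geometric_small kap01 B0 e0.
(* [Y] is nonnegative everywhere, equal to [1] at [0], and small on [E]; hence
   [v = (1 - Y) / 'X] is a polynomial that is close to [t^-1] on [E]. *)
pose Y : {poly R} := (1 - 'X ^+ 2) ^+ (2 * N).
have YE t : Y.[t] = (1 - t ^+ 2) ^+ (2 * N) by rewrite /Y !(horner_exp, hornerE).
have Y0 t : 0 <= Y.[t] by rewrite YE exprM exprn_ge0// sqr_ge0.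
have YkapE t : E t -> Y.[t] <= kap ^+ N.
  move=> Et; have /andP[t1 t2] := E1 Et; have := dS _ (Egap Et) => dt.
  have tt : t ^+ 2 = `|t| ^+ 2 by rewrite real_normK ?num_real.
  have u0 : 0 <= 1 - t ^+ 2 <= kap.
    rewrite subr_ge0 tt expr_le1 ?ler_norml ?t1 ?t2//= lerD2l lerN2.
    by rewrite lerXn2r ?nnegrE// ltW.
  have /andP[u1 u2] := u0.
  rewrite YE mulnC exprM (@le_trans _ _ ((1 - t ^+ 2) ^+ N))//.
    rewrite expr2 ler_piMr ?exprn_ge0// exprn_ile1//.
    by rewrite (le_trans u2)// ltW.
  by rewrite lerXn2r ?nnegrE.
have rY : root (1 - Y) 0 by rewrite /root hornerD hornerN YE hornerC expr0n subr0 expr1n subrr.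
have /factor_theorem[v vY] := rY.
have vE t : t != 0 -> v.[t] = t^-1 * (1 - Y.[t]).
  move=> t0; have : (1 - Y).[t] = v.[t] * t by rewrite vY hornerM hornerXsubC subr0.
  by rewrite hornerD hornerN hornerC => ->; rewrite mulrCA mulVf// mulr1.
pose h := 'X * v ^+ k.+1.
pose G := delta^-1 ^+ k *: (k.+1%:R *: Y + 2 *: Y ^+ k.+1).
have GE t : G.[t] = delta^-1 ^+ k * (k.+1%:R * Y.[t] + 2 * Y.[t] ^+ k.+1).
  by rewrite /G !(hornerZ, hornerD, horner_exp).
have G0 t : 0 <= G.[t].
  rewrite GE mulr_ge0 ?exprn_ge0 ?invr_ge0 ?(ltW d0)// addr_ge0// mulr_ge0//.
  by rewrite exprn_ge0.
have hG t : [\/ t <= alpha, t = 0 | beta <= t] -> `|inverse_power k t - h.[t]| <= G.[t].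
  move=> ht; have [->|t0] := eqVneq t 0.
    by rewrite /inverse_power mul0r /h hornerM hornerX mul0r subrr normr0.
  have dt : delta <= `|t|.
    by apply: dS; case: ht => [|tz|]; [left|rewrite tz eqxx in t0|right].
  have -> : inverse_power k t - h.[t] = t^-1 ^+ k * (1 - (1 - Y.[t]) ^+ k.+1).
    rewrite /inverse_power /h hornerM horner_exp hornerX vE// exprMn mulrA.
    by rewrite exprS mulrA mulfV// mul1r; ring.
  rewrite normrM GE ler_pM// ?one_sub_exp_bound//.
  rewrite normrX normfV lerXn2r ?nnegrE ?invr_ge0 ?normr_ge0 ?(ltW d0)//.
  by rewrite lef_pV2 ?posrE// normr_gt0.
exists (maxn (size h) (size G)) => d xs w dd quad nodes.
have GI : I G <= C * kap ^+ N * s0.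
  rewrite (le_trans (ler_norm _))//; apply: Rintegral_bound => //.
    exact: integrable_horner.
  move=> t Et; rewrite ger0_norm// GE /C -mulrA ler_wpM2l//.
    by rewrite exprn_ge0// invr_ge0 ltW.
  have Yk := YkapE _ Et; have kN1 : kap ^+ N <= 1 by rewrite exprn_ile1// ltW.
  have YY : Y.[t] ^+ k.+1 <= Y.[t].
    by rewrite exprS ler_piMr// exprn_ile1// (le_trans Yk).
  rewrite [leRHS]mulrDl lerD// ?ler_wpM2l//; exact: (le_trans YY).
have hd : (size h <= d.+1)%N by apply/leqW/(leq_trans _ dd); rewrite leq_maxl.
have Gd : (size G <= d.+1)%N by apply/leqW/(leq_trans _ dd); rewrite leq_maxr.
have := quadrature_error_le quad hd Gd (inverse_power_integrable k).
move=> /(_ _)/le_trans; apply.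
  move=> t [txs|Et]; apply: hG; first exact: nodes.
  by case: (Egap Et); [constructor 1|constructor 3].
apply: (@le_trans _ _ (2 * (C * kap ^+ N * s0))); first by rewrite ler_pM2l.
rewrite ltW// (le_lt_trans _ hN)// le_eqVlt; apply/orP; left; apply/eqP; ring.
Qed.

Lemma eventually_all K (Q : nat -> nat -> Prop) :
  (forall k, exists d0, forall d, (d0 <= d)%N -> Q k d) ->
  exists d0, forall d, (d0 <= d)%N -> forall k, (k < K)%N -> Q k d.
Proof.
move=> hQ; elim: K => [|K [d1 h1]]; first by exists 0%N.
have [d2 h2] := hQ K; exists (maxn d1 d2) => d; rewrite geq_max => /andP[hd1 hd2] k.
by rewrite ltnS leq_eqVlt => /orP[/eqP->|kK]; [exact: h2|exact: h1].
Qed.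

Local Notation cint := (@cintegrable R E sigma).

Definition quadrature_error (xs : seq R) (w : R -> R) (f : R -> R[i]) : R[i] :=
  \sum_(x <- xs) (w x)%:C * f x - cintegral sigma E f.

Lemma quadrature_error_real xs w (f : R -> R) :
  quadrature_error xs w (fun t => (f t)%:C) =
  (\sum_(x <- xs) w x * f x - (\int[sigma]_(t in E) f t)%R)%:C.
Proof.
rewrite /quadrature_error cintegral_real rmorphB rmorph_sum /=; congr (_ - _).
by apply: eq_bigr => x _; rewrite rmorphM.
Qed.

Lemma quadrature_errorD xs w f g : cint f -> cint g ->
  quadrature_error xs w (fun t => f t + g t) =
  quadrature_error xs w f + quadrature_error xs w g.
Proof.
move=> hf hg; rewrite /quadrature_error cintegralD// opprD.
under eq_bigr do rewrite mulrDr.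
by rewrite big_split /= addrACA.
Qed.

Lemma quadrature_error_sum xs w K (a : nat -> R[i]) (F : nat -> R -> R[i]) :
  (forall k, cint (F k)) ->
  quadrature_error xs w (fun t => \sum_(k < K) a k * F k t) =
  \sum_(k < K) a k * quadrature_error xs w (F k).
Proof.
move=> hF; rewrite /quadrature_error.
rewrite (@cintegral_sum _ _ _ compactE K (fun k t => a k * F k t)); last first.
  by move=> k; exact: cintegrableZ.
under eq_bigr do rewrite mulr_sumr.
rewrite exchange_big -sumrB /=; apply: eq_bigr => k _.
rewrite cintegralZ// mulrBr mulr_sumr; congr (_ - _).
by apply: eq_bigr => x _; rewrite mulrCA.
Qed.

Lemma eq_quadrature_error xs w (f g : R -> R[i]) :
  (forall t, t \in xs \/ E t -> f t = g t) ->
  quadrature_error xs w f = quadrature_error xs w g.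
Proof.
move=> fg; rewrite /quadrature_error; congr (_ - _).
  by rewrite big_seq [RHS]big_seq; apply: eq_bigr => x xxs; rewrite fg//; left.
by rewrite /cintegral; congr (_ +i* _); apply: eq_Rintegral => t /set_mem Et;
  rewrite fg//; right.
Qed.

Lemma quadrature_error_bound d xs w f e : quadrature I d xs w -> cint f ->
  (forall t, t \in xs \/ E t -> normc (f t) <= e) ->
  normc (quadrature_error xs w f) <= 3 * (e * s0).
Proof.
move=> quad fint fe; have [_ wpos _] := quad.
rewrite (_ : 3 = 1 + 2 :> R); last by ring.
rewrite mulrDl mul1r (le_trans (le_normcD _ _))// lerD//.
  rewrite -(sum_weights quad) mulr_sumr (le_trans (le_normc_sum _ _))//.
  rewrite big_seq [leRHS]big_seq; apply: ler_sum => x xxs.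
  rewrite normcM normc_real (gtr0_norm (wpos _ xxs)) mulrC ler_pM2r ?wpos//.
  by apply: fe; left.
by rewrite normcN; apply: cintegral_bound => // t Et; apply: fe; right.
Qed.

(** The factor [t * t^-1] is [1] except at [t = 0], where it makes the value [0]. *)
Definition inverse_poly (q : {poly R[i]}) (t : R) : R[i] :=
  (t * t^-1)%:C * q.[(t^-1)%:C].

Lemma inverse_polyE q t :
  inverse_poly q t = \sum_(j < size q) q`_j * (inverse_power j t)%:C.
Proof.
rewrite /inverse_poly horner_coef mulr_sumr; apply: eq_bigr => j _.
by rewrite mulrCA -rmorphXn -rmorphM /inverse_power exprS mulrA.
Qed.

Lemma inverse_poly_integrable q : cint (inverse_poly q).
Proof.
rewrite (_ : inverse_poly q = fun t => \sum_(j < size q) q`_j * (inverse_power j t)%:C).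
  apply: (@cintegrable_sum _ _ sigma compactE _ (fun j t => q`_j * (inverse_power j t)%:C)) => k.
  by apply: cintegrableZ => //; apply: cintegrable_real; exact: inverse_power_integrable.
by apply/funext => t; rewrite inverse_polyE.
Qed.

Lemma inverse_poly_cvg q e : 0 < e -> exists d0, forall d, (d0 <= d)%N ->
  forall xs w, quadrature I d xs w -> outside_gap xs ->
  normc (quadrature_error xs w (inverse_poly q)) <= e.
Proof.
move=> e0; pose S := \sum_(j < size q) normc q`_j.
have S0 : 0 <= S by apply: sumr_ge0 => j _; exact: normc_ge0.
have S1 : 0 < S + 1 by rewrite ltr_wpDl.
have [d0 hd0] := @eventually_all (size q) (fun j d => forall xs w,
    quadrature I d xs w -> outside_gap xs ->
    `|\sum_(x <- xs) w x * inverse_power j x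
      - (\int[sigma]_(t in E) inverse_power j t)%R| <= e / (S + 1))
  (fun j => let: ex_intro d1 h := inverse_moment_cvg j (divr_gt0 e0 S1) in
     ex_intro _ d1 (fun d dd xs w => h d xs w dd)).
exists d0 => d dd xs w quad nodes.
rewrite (_ : inverse_poly q = fun t => \sum_(j < size q) q`_j * (inverse_power j t)%:C); last first.
  by apply/funext => t; rewrite inverse_polyE.
rewrite (@quadrature_error_sum _ _ _ (fun j => q`_j)
  (fun j t => (inverse_power j t)%:C)); last first.
  by move=> k; apply: cintegrable_real; exact: inverse_power_integrable.
rewrite (le_trans (le_normc_sum _ _))// (@le_trans _ _ (S * (e / (S + 1))))//.
  rewrite /S mulr_suml; apply: ler_sum => j _.
  rewrite normcM ler_wpM2l ?normc_ge0// quadrature_error_real normc_real.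
  exact: (hd0 d dd).
by rewrite mulrCA ler_piMr ?(ltW e0)// ler_pdivrMr// mul1r lerDl.
Qed.

(** A disc around a suitable, possibly far away and non-real centre [c] contains
    the interval from [alpha^-1] to [beta^-1] but not the point [l^-1]. *)
Lemma separating_disc (l : R[i]) :
  (forall t : R, t <= alpha \/ beta <= t -> l != t%:C) ->
  exists (c : R[i]) (rho : R), [/\ 0 <= rho,
    forall t : R, t <= alpha \/ beta <= t -> normc ((t^-1)%:C - c) <= rho &
    rho * normc l < normc (1 - c * l)].
Proof.
case: l => x y hl.
have tinv t : t <= alpha \/ beta <= t -> alpha^-1 <= t^-1 <= beta^-1.
  have a0 : alpha^-1 < 0 by rewrite invr_lt0.
  have b0 : 0 < beta^-1 by rewrite invr_gt0.
  case=> ht; apply/andP; split.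
  - by rewrite lef_nV2 ?negrE// (le_lt_trans ht).
  - by rewrite ltW// (lt_trans _ b0)// invr_lt0 (le_lt_trans ht).
  - by rewrite ltW// (lt_trans a0)// invr_gt0 (lt_le_trans beta0).
  - by rewrite lef_pV2 ?posrE// (lt_le_trans beta0).
have a0 : alpha^-1 < 0 by rewrite invr_lt0.
have b0 : 0 < beta^-1 by rewrite invr_gt0.
have [y0|y0] := eqVneq y 0.
  rewrite y0 in hl *.
  have xa : alpha < x.
    by rewrite ltNge; apply/negP => h; have := hl x (or_introl h); rewrite eqxx.
  have xb : x < beta.
    by rewrite ltNge; apply/negP => h; have := hl x (or_intror h); rewrite eqxx.
  exists ((alpha^-1 + beta^-1) / 2)%:C, ((beta^-1 - alpha^-1) / 2); split.
  - by rewrite divr_ge0// subr_ge0 ltW// (lt_trans a0).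
  - by move=> t /tinv/andP[h1 h2]; rewrite -rmorphB normc_real ler_norml; lra.
  rewrite -[x +i* 0]/(x%:C) -rmorphM -(rmorph1 (real_complex R)) -rmorphB !normc_real.
  have h1 : 0 < 1 - x * alpha^-1.
    by rewrite subr_gt0 mulrC -ltr_ndivrMl ?mulr1 ?invrK ?invr_lt0.
  have h2 : 0 < 1 - x * beta^-1 by rewrite subr_gt0 ltr_pdivrMr// mul1r.
  rewrite (lt_le_trans _ (ler_norm _))//.
  by have [x0|x0] := leP 0 x; [rewrite ger0_norm//|rewrite ltr0_norm//]; nra.
(* For non-real [l = x + i y] the centre goes to [i M y] with [M] large; then
   [|1 - c l|^2] exceeds [(B^2 + |c|^2) |l|^2] by [1 + 2 M y^2 - B^2 |l|^2], which
   is [1] for the following [M]. *)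
pose B := beta^-1 - alpha^-1.
pose M := B ^+ 2 * (x ^+ 2 + y ^+ 2) / (2 * y ^+ 2).
have y2 : 0 < y ^+ 2 by rewrite exprn_even_gt0.
have My : 2 * (M * y ^+ 2) = B ^+ 2 * (x ^+ 2 + y ^+ 2).
  by rewrite /M; field; rewrite y0.
exists (0 +i* (M * y)), (Num.sqrt (B ^+ 2 + (M * y) ^+ 2)); split.
- exact: sqrtr_ge0.
- move=> t /tinv/andP[h1 h2]; rewrite /normc /= ler_wsqrtr//.
  rewrite subr0 sub0r sqrrN lerD2r -[leLHS]real_normK ?num_real//.
  rewrite lerXn2r ?nnegrE ?normr_ge0//; first by rewrite /B; lra.
  by rewrite ler_norml /B; lra.
rewrite /normc /= -sqrtrM; last by rewrite addr_ge0 ?sqr_ge0.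
rewrite ltr_sqrt.
  rewrite !mul0r !sub0r !add0r opprK.
  have -> : (1 + M * y * y) ^+ 2 + (- (M * y * x)) ^+ 2 =
    1 + 2 * (M * y ^+ 2) + (M * y) ^+ 2 * (x ^+ 2 + y ^+ 2) by ring.
  by rewrite My mulrDl ltrD2r ltrDr.
rewrite !mul0r !sub0r !add0r opprK ltr_pwDl ?sqr_ge0// exprn_gt0// ltr_pwDl//.
have M0 : 0 <= M.
  apply: mulr_ge0; last by rewrite invr_ge0; apply: mulr_ge0 => //; exact: ltW.
  by apply: mulr_ge0; [exact: sqr_ge0|rewrite addr_ge0 ?sqr_ge0].
by rewrite -mulrA -expr2; apply: mulr_ge0 => //; exact: ltW.
Qed.

Definition cauchy_kernel (z : R[i]) (t : R) : R[i] := t%:C / (t%:C - z).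

Let cut (t : R) := t <= alpha \/ beta <= t.

Let cut_neq0 t : cut t -> t != 0.
Proof.
by case=> h; [rewrite lt_eqF// (le_lt_trans h)|rewrite gt_eqF// (lt_le_trans beta0)].
Qed.

(** With [u = t^-1] the kernel is [(1 - u z)^-1]; expanded in powers of [u - c]
    it converges geometrically, uniformly for [u] in the disc of centre [c]. *)
Lemma cauchy_kernel_expansion (c z : R[i]) (rho kap g : R) K t :
  0 < g -> 0 <= kap < 1 -> g <= normc (1 - c * z) ->
  rho * normc z <= kap * normc (1 - c * z) ->
  (cut t -> normc ((t^-1)%:C - c) <= rho) -> t = 0 \/ cut t ->
  (cut t -> z != t%:C) /\
  normc (cauchy_kernel z t -
     \sum_(k < K) z ^+ k / (1 - c * z) ^+ k.+1 * inverse_poly (('X - c%:P) ^+ k) t)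
  <= kap ^+ K / (g * (1 - kap)).
Proof.
move=> g0 /andP[kap0 kap1] gD rhoD trho ht.
set D := 1 - c * z in gD rhoD *.
have D0 : 0 < normc D by exact: lt_le_trans gD.
have Dn0 : D != 0 by rewrite -normc_gt0.
have k1 : 0 < 1 - kap by rewrite subr_gt0.
have rhs0 : 0 <= kap ^+ K / (g * (1 - kap)).
  by rewrite divr_ge0 ?exprn_ge0// mulr_ge0 ?(ltW g0)// ltW.
have [t0|t0] := eqVneq t 0.
  split=> [/cut_neq0|]; first by rewrite t0 eqxx.
  rewrite t0 /cauchy_kernel rmorph0 mul0r big1 ?subrr ?normc0//.
  by move=> k _; rewrite /inverse_poly mul0r rmorph0 mul0r mulr0.
have tcut : cut t by case: ht => // t00; rewrite t00 eqxx in t0.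
have {}trho := trho tcut.
have tC0 : t%:C != 0 by rewrite (inj_eq (@complexI _)).
have uE : (t^-1)%:C = (t%:C)^-1 by rewrite fmorphV.
pose q := ((t%:C)^-1 - c) * z / D.
have qk : normc q <= kap.
  rewrite /q !normcM normcV ler_pdivrMr// (le_trans _ rhoD)// -uE.
  by rewrite ler_wpM2r// normc_ge0.
have q1 : 1 - kap <= normc (1 - q).
  by rewrite (le_trans _ (le_normcB _ _))// normc1 lerD2l lerN2.
have qn1 : 1 - q != 0 by rewrite -normc_gt0 (lt_le_trans _ q1).
have tz : t%:C - z = t%:C * D * (1 - q).
  by rewrite /q /D; field; rewrite Dn0 tC0.
have tzn0 : t%:C - z != 0 by rewrite tz !mulf_neq0.
split=> [_|]; first by rewrite eq_sym -subr_eq0.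
have -> : \sum_(k < K) z ^+ k / D ^+ k.+1 * inverse_poly (('X - c%:P) ^+ k) t =
    D^-1 * \sum_(k < K) q ^+ k.
  rewrite mulr_sumr; apply: eq_bigr => k _.
  rewrite /inverse_poly divff// rmorph1 mul1r horner_exp hornerXsubC uE.
  by rewrite /q !exprMn exprVn exprS invfM; ring.
have -> : cauchy_kernel z t - D^-1 * \sum_(k < K) q ^+ k = q ^+ K / (D * (1 - q)).
  have e : \sum_(k < K) q ^+ k = (1 - q ^+ K) / (1 - q).
    apply: (mulIf qn1); rewrite divfK// mulrC.
    by have := subrX1 q K => /(congr1 -%R); rewrite opprB -mulNr opprB => ->.
  rewrite e /cauchy_kernel tz.
  by field; rewrite Dn0 qn1 tC0.
rewrite !normcM normcV normcM normcX ler_pM ?exprn_ge0 ?normc_ge0//.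
- by rewrite invr_ge0 mulr_ge0 ?normc_ge0.
- by rewrite lerXn2r ?nnegrE ?normc_ge0.
- by rewrite lef_pV2 ?posrE ?mulr_gt0 ?normc_gt0// ler_pM// ltW.
Qed.

(** In the expansion in powers of [u - c] every coefficient function has a small
    quadrature error, and the tail is uniformly small on all nodes and on [E]. *)
Theorem quadrature_cauchy_cvg (l : R[i]) : (forall t, cut t -> l != t%:C) ->
  exists r : R, [/\ 0 < r,
    forall z, normc (z - l) < r -> forall t, cut t -> z != t%:C &
    forall e, 0 < e -> exists d0, forall d, (d0 <= d)%N -> forall xs w,
      quadrature I d xs w -> outside_gap xs -> forall z, normc (z - l) < r ->
      normc (quadrature_error xs w (cauchy_kernel z)) < e].
Proof.
move=> lcut; have [c [rho [rho0 crho sep]]] := separating_disc lcut.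
(* The gap [2 g] in the separation survives, halved, on a small disc around [l]. *)
pose g := (normc (1 - c * l) - rho * normc l) / 2.
have g0 : 0 < g by rewrite divr_gt0// subr_gt0.
pose nc := normc c; have nc0 : 0 <= nc := normc_ge0 c.
pose r := g / (nc + rho + 1).
have nr1 : 0 < nc + rho + 1 by lra.
have r0 : 0 < r by rewrite divr_gt0.
have rg : (nc + rho) * r <= g.
  by rewrite mulrCA ler_piMr ?(ltW g0)// ler_pdivrMr// mul1r; lra.
pose Gam := normc (1 - c * l) + nc * r.
have near_l z : normc (z - l) < r ->
    [/\ rho * normc z + g <= normc (1 - c * z), normc (1 - c * z) <= Gam
      & normc z <= normc l + r].
  move=> zr.
  have e : 1 - c * z = 1 - c * l - c * (z - l) by ring.
  have h1 : normc (1 - c * l) - nc * normc (z - l) <= normc (1 - c * z).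
    by rewrite e -normcM le_normcB.
  have h2 : normc (1 - c * z) <= normc (1 - c * l) + nc * normc (z - l).
    by rewrite e -normcM -[leRHS]/(_ + _) -(normcN (c * _)) le_normcD.
  have h3 : normc z <= normc l + normc (z - l).
    by rewrite -{1}(subrK l z) addrC le_normcD.
  have h4 : 2 * g = normc (1 - c * l) - rho * normc l by rewrite /g; field.
  have h5 : nc * normc (z - l) <= nc * r by rewrite ler_wpM2l// ltW.
  have h6 : rho * normc z <= rho * (normc l + r) by rewrite ler_wpM2l//; lra.
  rewrite /Gam; split; lra.
have Gam0 : g <= Gam.
  have ll : normc (l - l) < r by rewrite subrr normc0.
  have [h1 h2 _] := near_l l ll.
  have h := mulr_ge0 rho0 (normc_ge0 l); lra.
have Gam1 : 0 < Gam by lra.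
pose kap := 1 - g / Gam.
have kap01 : 0 <= kap < 1.
  by rewrite /kap subr_ge0 ler_pdivrMr// mul1r Gam0 ltrBlDr ltrDl divr_gt0.
have near_kap z : normc (z - l) < r ->
   g <= normc (1 - c * z) /\ rho * normc z <= kap * normc (1 - c * z).
  move=> /near_l[h1 h2 _]; have h := mulr_ge0 rho0 (normc_ge0 z).
  split; first lra.
  have : g / Gam * normc (1 - c * z) <= g by rewrite mulrAC ler_pdivrMr// ler_pM2l.
  rewrite /kap mulrBl mul1r; lra.
have zcut z : normc (z - l) < r -> forall t, cut t -> z != t%:C.
  move=> /near_kap[h1 h2] t tc.
  have [] := cauchy_kernel_expansion 0 g0 kap01 h1 h2 (crho t) (or_intror tc).
  by move=> /(_ tc).
exists r; split => // e e0.
have /andP[kap0 kap1] := kap01.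
have gk : 0 < g * (1 - kap) by rewrite mulr_gt0// subr_gt0.
have C0 : 0 <= 3 * s0 / (g * (1 - kap)).
  by apply: mulr_ge0; [exact: mulr_ge0|rewrite invr_ge0 ltW].
have e2 : 0 < e / 2 by rewrite divr_gt0.
have [K hK] := geometric_small kap01 C0 e2.
pose A k := (normc l + r) ^+ k / g ^+ k.+1.
have A0 k : 0 <= A k.
  by rewrite divr_ge0 ?exprn_ge0 ?(ltW g0)// addr_ge0 ?normc_ge0// ltW.
pose S := \sum_(k < K) A k.
have S0 : 0 <= S by exact: sumr_ge0.
have S1 : 0 < S + 1 by rewrite ltr_wpDl.
pose F k := inverse_poly (('X - c%:P) ^+ k).
have [d0 hd0] := @eventually_all K (fun k d => forall xs w,
    quadrature I d xs w -> outside_gap xs ->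
    normc (quadrature_error xs w (F k)) <= e / 2 / (S + 1))
  (fun k => inverse_poly_cvg (('X - c%:P) ^+ k) (divr_gt0 e2 S1)).
exists d0 => d dd xs w quad nodes z zl.
have [h1 h2] := near_kap z zl; have [_ _ h3] := near_l z zl.
have zE t : E t -> t%:C != z by move=> /Egap tc; rewrite eq_sym zcut.
pose a k : R[i] := z ^+ k / (1 - c * z) ^+ k.+1.
have Fint k : cint (F k) by exact: inverse_poly_integrable.
have Sint : cint (fun t => \sum_(k < K) a k * F k t).
  apply: (@cintegrable_sum _ _ sigma compactE _ (fun k t => a k * F k t)) => k.
  exact: cintegrableZ.
have cauint : cint (cauchy_kernel z) by exact: cintegrable_cauchy.
pose f t := cauchy_kernel z t + (-1) * \sum_(k < K) a k * F k t.
have fint : cint f by apply: cintegrableD => //; exact: cintegrableZ.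
rewrite (@eq_quadrature_error xs w _ (fun t => f t + \sum_(k < K) a k * F k t)); last first.
  by move=> t _; rewrite /f mulN1r subrK.
rewrite quadrature_errorD// quadrature_error_sum//.
rewrite (le_lt_trans (le_normcD _ _))// [e]splitr ltr_leD//.
  apply: (le_lt_trans (@quadrature_error_bound d xs w f (kap ^+ K / (g * (1 - kap))) quad fint _)).
    move=> t ht; rewrite /f mulN1r.
    have tz : t = 0 \/ cut t.
      case: ht => [/nodes|/Egap]; last by right.
      by case=> h; [right; left|left|right; right].
    by have [] := cauchy_kernel_expansion K g0 kap01 h1 h2 (crho t) tz.
  by apply: le_lt_trans hK; rewrite le_eqVlt; apply/orP; left; apply/eqP; ring.
rewrite (le_trans (le_normc_sum _ _))// (@le_trans _ _ (S * (e / 2 / (S + 1))))//.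
  rewrite /S mulr_suml; apply: ler_sum => k _.
  rewrite normcM ler_pM ?normc_ge0 ?(hd0 d dd)//.
  rewrite /a normcM normcV !normcX /A ler_pM ?exprn_ge0 ?invr_ge0 ?exprn_ge0 ?normc_ge0//.
    by rewrite lerXn2r ?nnegrE ?normc_ge0// addr_ge0 ?normc_ge0// ltW.
  by rewrite lef_pV2 ?posrE ?exprn_gt0 ?(lt_le_trans g0 h1)// lerXn2r ?nnegrE ?normc_ge0// ltW.
by rewrite mulrCA ler_piMr ?(ltW e2)// ler_pdivrMr// mul1r lerDl.
Qed.

(** Truncated geometric series in [t / z]: the remainder is [(t / z) ^ K] times the
    kernel. *)
Lemma cauchy_kernel_far (B : R) (z : R[i]) K t : `|t| <= B -> B < normc z ->
  normc (cauchy_kernel z t + \sum_(k < K) z ^- k.+1 * (t ^+ k.+1)%:C)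
  <= (B / normc z) ^+ K * (B / (normc z - B)).
Proof.
move=> tB Bz; have B0 : 0 <= B := le_trans (normr_ge0 _) tB.
have z0 : 0 < normc z by exact: le_lt_trans Bz.
have zn0 : z != 0 by rewrite -normc_gt0.
have h1 : normc z - B <= normc (t%:C - z).
  rewrite normcBC (le_trans _ (le_normcB _ _))// normc_real; lra.
have tz : t%:C - z != 0 by rewrite -normc_gt0; lra.
pose q := t%:C / z.
have -> : \sum_(k < K) z ^- k.+1 * (t ^+ k.+1)%:C = q * \sum_(k < K) q ^+ k.
  rewrite mulr_sumr; apply: eq_bigr => k _.
  by rewrite -exprS /q exprMn exprVn rmorphXn mulrC.
have -> : cauchy_kernel z t + q * \sum_(k < K) q ^+ k = q ^+ K * (t%:C / (t%:C - z)).
  have e : (q - 1) * \sum_(k < K) q ^+ k = q ^+ K - 1 by rewrite -subrX1.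
  have tzE : t%:C - z = z * (q - 1) by rewrite /q; field.
  have q1 : q - 1 != 0.
    by apply: contraNneq tz => h; rewrite tzE h mulr0.
  have -> : \sum_(k < K) q ^+ k = (q ^+ K - 1) / (q - 1).
    by apply: (mulfI q1); rewrite e mulrCA divff// mulr1.
  rewrite /cauchy_kernel tzE.
  have -> : t%:C = q * z by rewrite /q divfK.
  by field; rewrite q1.
rewrite !normcM normcX /q normcM !normcV normc_real.
rewrite ler_pM ?mulr_ge0 ?exprn_ge0 ?mulr_ge0 ?invr_ge0 ?normc_ge0//.
  rewrite lerXn2r ?nnegrE ?mulr_ge0 ?invr_ge0 ?normc_ge0//.
  by rewrite ler_wpM2r// invr_ge0 normc_ge0.
rewrite ler_pM ?invr_ge0 ?normc_ge0// lef_pV2 ?posrE ?subr_gt0//.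
by rewrite (lt_le_trans _ h1)// subr_gt0.
Qed.

Lemma powers_integrable (a : nat -> R[i]) K :
  cint (fun t => \sum_(k < K) a k * (t ^+ k.+1)%:C).
Proof.
apply: (@cintegrable_sum _ _ sigma compactE _ (fun k t => a k * (t ^+ k.+1)%:C)) => k.
apply: cintegrableZ => //; apply: cintegrable_real.
have := @integrable_horner _ _ sigma compactE ('X^(k.+1)).
by under eq_fun do rewrite hornerXn.
Qed.

Let cauchy_integrable_far z : 1 < normc z -> cint (cauchy_kernel z).
Proof.
move=> z1; apply: cintegrable_cauchy => // t /E1 t1.
apply/eqP => tz; move: z1; rewrite -tz normc_real.
by rewrite ltNge ler_norml t1.
Qed.

(** Only the remainder of order [d] contributes, the powers being integrated
    exactly. *)
Lemma quadrature_cauchy_far d xs w (B : R) (z : R[i]) :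
  quadrature I d xs w -> 1 <= B -> (forall x, x \in xs -> `|x| <= B) ->
  B < normc z ->
  normc (quadrature_error xs w (cauchy_kernel z)) <=
    3 * ((B / normc z) ^+ d * (B / (normc z - B)) * s0).
Proof.
move=> quad B1 xB Bz; pose a k : R[i] := z ^- k.+1.
have z1 : 1 < normc z by exact: le_lt_trans Bz.
have powint := powers_integrable a d.
have powerr : quadrature_error xs w (fun t => \sum_(k < d) a k * (t ^+ k.+1)%:C) = 0.
  rewrite (@quadrature_error_sum _ _ _ a (fun k t => (t ^+ k.+1)%:C)).
    rewrite big1// => k _; rewrite quadrature_error_real.
    have [_ _ /(_ 'X^(k.+1))] := quad.
    rewrite size_polyXn ltnS ltn_ord => /(_ isT).
    rewrite /I /moment; under eq_Rintegral do rewrite hornerXn.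
    by move=> ->; under [X in _ - X]eq_bigr do rewrite hornerXn; rewrite subrr rmorph0 mulr0.
  move=> k; apply: cintegrable_real.
  have := @integrable_horner _ _ sigma compactE ('X^(k.+1)).
  by under eq_fun do rewrite hornerXn.
have cauint := cauchy_integrable_far z1.
rewrite -[quadrature_error _ _ _]addr0 -{1}powerr -quadrature_errorD//.
apply: quadrature_error_bound (quad) _ _; first exact: cintegrableD.
move=> t ht; apply: cauchy_kernel_far => //.
by case: ht => [/xB//|/E1 t1]; rewrite (le_trans _ B1)// ler_norml.
Qed.

Theorem quadrature_cauchy_cvg_infty (B r e : R) : 1 <= B -> B < r -> 0 < e ->
  exists d0, forall d, (d0 <= d)%N -> forall xs w,
    quadrature I d xs w -> (forall x, x \in xs -> `|x| <= B) ->
    forall z, r <= normc z -> normc (quadrature_error xs w (cauchy_kernel z)) < e.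
Proof.
move=> B1 Br e0; have B0 : 0 < B by exact: lt_le_trans B1.
have r0 : 0 < r by exact: lt_trans Br.
have k01 : 0 <= B / r < 1 by rewrite divr_ge0 ?(ltW B0) ?(ltW r0)//= ltr_pdivrMr// mul1r.
have rB : 0 < r - B by rewrite subr_gt0.
have C0 : 0 <= 3 * (B / (r - B) * s0).
  by apply: mulr_ge0 => //; apply: mulr_ge0 => //; rewrite divr_ge0// ltW.
have [N hN] := geometric_small k01 C0 e0.
exists N => d Nd xs w quad xB z rz.
have Bz : B < normc z by exact: lt_le_trans rz.
have z0 : 0 < normc z by exact: lt_trans Bz.
rewrite (le_lt_trans (quadrature_cauchy_far quad B1 xB Bz))// (le_lt_trans _ hN)//.
rewrite [leRHS](_ : _ = 3 * ((B / r) ^+ N * (B / (r - B)) * s0)); last by ring.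
have /andP[k0 k1] := k01.
rewrite ler_pM2l// ler_wpM2r// ler_pM ?exprn_ge0 ?divr_ge0 ?subr_ge0 ?(ltW B0) ?(ltW z0) ?(ltW Bz)//.
  rewrite (@le_trans _ _ ((B / r) ^+ d))//.
    rewrite lerXn2r ?nnegrE ?divr_ge0 ?(ltW B0) ?(ltW z0) ?(ltW r0)//.
    by rewrite ler_pM2l// lef_pV2 ?posrE.
  by rewrite -(subnKC Nd) exprD ler_piMr ?exprn_ge0// exprn_ile1// ltW.
by rewrite ler_pM2l// lef_pV2 ?posrE ?subr_gt0// lerD2r.
Qed.

(** The bound of [cauchy_kernel_far] with [B = 1], integrated. *)
Lemma cauchy_moment_expansion J (z : R[i]) : 1 < normc z ->
  normc (cintegral sigma E (cauchy_kernel z) +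
         \sum_(k < J) (I 'X^(k.+1))%:C * z ^- k.+1)
  <= 2 * ((1 / normc z) ^+ J * (1 / (normc z - 1)) * s0).
Proof.
move=> z1; have cauint := cauchy_integrable_far z1.
have -> : \sum_(k < J) (I 'X^(k.+1))%:C * z ^- k.+1 =
    cintegral sigma E (fun t => \sum_(k < J) z ^- k.+1 * (t ^+ k.+1)%:C).
  have pint k : cint (fun t => (t ^+ k.+1)%:C).
    apply: cintegrable_real; have := @integrable_horner _ _ sigma compactE ('X^(k.+1)).
    by under eq_fun do rewrite hornerXn.
  rewrite (@cintegral_sum _ _ _ compactE J (fun k t => z ^- k.+1 * (t ^+ k.+1)%:C)).
    apply: eq_bigr => k _; rewrite cintegralZ// cintegral_real mulrC.
    by rewrite /I /moment; under eq_Rintegral do rewrite hornerXn.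
  by move=> k; exact: cintegrableZ.
rewrite -cintegralD//; last exact: (powers_integrable (fun k => z ^- k.+1)).
apply: cintegral_bound => //.
  by apply: cintegrableD => //; exact: (powers_integrable (fun k => z ^- k.+1)).
by move=> t /E1 t1; apply: cauchy_kernel_far => //; rewrite ler_norml.
Qed.

End Convergence.

(** * Growth of complex polynomials *)

Section PolynomialGrowth.
Context {R : realType}.
Implicit Types p q : {poly R[i]}.

Lemma poly_upper_growth p m : (size p <= m.+1)%N ->
  exists2 C : R, 0 <= C & forall z, 1 <= normc z -> normc p.[z] <= C * normc z ^+ m.
Proof.
move=> pm; exists (\sum_(i < size p) normc p`_i).
  by apply: sumr_ge0 => i _; exact: normc_ge0.
move=> z z1; rewrite horner_coef (le_trans (le_normc_sum _ _))// mulr_suml.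
apply: ler_sum => i _; rewrite normcM normcX ler_wpM2l ?normc_ge0//.
by rewrite ler_weXn2l// -ltnS (leq_trans (ltn_ord i)).
Qed.

(** Horner's scheme: [p z + c] is large where [p] is bounded below and [z] is
    large. *)
Lemma poly_lower_growth p : p != 0 -> exists M delta : R,
  0 < delta /\ forall z, M <= normc z -> delta <= normc p.[z].
Proof.
elim/poly_ind: p => [|p c IH]; first by rewrite eqxx.
have [->|p0 _] := eqVneq p 0.
  rewrite mul0r add0r polyC_eq0 => c0; exists 0, (normc c).
  by split=> [|z _]; rewrite ?normc_gt0// hornerC.
have [M [delta [d0 hd]]] := IH p0.
exists (Num.max M ((1 + normc c) / delta)), 1; split => // z.
rewrite ge_max => /andP[/hd h1 h2]; rewrite hornerMXaddC.
have h3 : normc (p.[z] * z) - normc c <= normc (p.[z] * z + c).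
  by rewrite -(normcN c) -[c in leRHS]opprK le_normcB.
rewrite (le_trans _ h3)// lerBrDr normcM.
rewrite (@le_trans _ _ (delta * normc z))//.
  by rewrite mulrC -ler_pdivrMr.
by rewrite ler_wpM2r// normc_ge0.
Qed.

Lemma poly_vanishing_at_infty p (K M : R) :
  (forall z, M < normc z -> normc p.[z] <= K / normc z) -> p = 0.
Proof.
move=> hK; apply/eqP/negPn/negP => /poly_lower_growth[M' [delta [d0 hd]]].
pose x := `|M| + `|M'| + `|K| / delta + 1.
have hM := ler_norm M; have hM' := ler_norm M'; have hM0 := normr_ge0 M.
have hM'0 := normr_ge0 M'.
have hK0 : 0 <= `|K| / delta by rewrite divr_ge0// ltW.
have x0 : 0 < x by rewrite /x; lra.
have nx : normc x%:C = x by rewrite normc_real gtr0_norm.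
have h1 : M < normc x%:C by rewrite nx /x; lra.
have h2 : M' <= normc x%:C by rewrite nx /x; lra.
have := le_trans (hd _ h2) (hK _ h1); rewrite nx ler_pdivlMr//.
have := ler_norm K.
have : `|K| < delta * x.
  by rewrite mulrC -ltr_pdivrMr// /x; lra.
lra.
Qed.

End PolynomialGrowth.

(** * Fractions on the sphere and reversed polynomials *)

Section Sphere.
Context {R : realType}.
Implicit Types p q : {poly R[i]}.

(** Cancelling the common factors of [p' / q'] gives the reduced fraction [p / q]
    up to a constant. *)
Lemma ratfunE p q p' q' : coprimep p q -> q' != 0 -> q != 0 -> p' * q = p * q' ->
  (size p < size q)%N ->
  ratfun p' q' = fun z => match z with
    | Some l => if q.[l] == 0 then None else Some (p.[l] / q.[l])
    | None => Some 0
    end.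
Proof.
move=> cpq q'0 q0 e spq.
pose g := gcdp p' q'; have g0 : g != 0 by rewrite gcdp_eq0 negb_and q'0 orbT.
have ep : p' %/ g * g = p' by rewrite divpK// dvdp_gcdl.
have eq : q' %/ g * g = q' by rewrite divpK// dvdp_gcdr.
have c1 : coprimep (p' %/ g) (q' %/ g) by apply: coprimep_div_gcd; rewrite q'0 orbT.
have e1 : p' %/ g * q = p * (q' %/ g).
  by apply: (mulIf g0); rewrite mulrAC ep -mulrA eq.
have q10 : q' %/ g != 0 by apply: contraNneq q'0 => h; rewrite -eq h mul0r.
have d1 : q %| q' %/ g.
  by rewrite -(Gauss_dvdpr _ (q := p)) 1?coprimep_sym// -e1 dvdp_mull.
have d2 : q' %/ g %| q.
  by rewrite -(Gauss_dvdpr _ (q := p' %/ g)) 1?coprimep_sym// e1 dvdp_mull.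
have /eqpP[[a b] /= /andP[a0 b0] ab] : q %= q' %/ g by rewrite /eqp d1.
pose c := b^-1 * a.
have c0 : c != 0 by rewrite mulf_neq0// invr_eq0.
have qE : q' %/ g = c *: q.
  by rewrite /c -scalerA ab scalerA mulVf// scale1r.
have pE : p' %/ g = c *: p.
  by apply: (mulIf q0); rewrite e1 qE -scalerAr -scalerAl.
apply/funext => -[l|]; rewrite /ratfun -/g pE qE.
  rewrite !hornerZ mulf_eq0 (negPf c0) /=; case: ifP => // ql.
  by rewrite -mulf_div divff// mul1r.
rewrite !size_scale// ltnNge (ltnW spq) /=.
rewrite coefZ nth_default ?mulr0 ?mul0r//.
by rewrite -ltnS (leq_trans spq)// leqSpred.
Qed.

Lemma size_reverse_poly m (p : {poly R[i]}) : (size (reverse_poly m p) <= m.+1)%N.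
Proof. exact: size_poly. Qed.

Lemma reverse_polyK m (p : {poly R[i]}) : (size p <= m.+1)%N ->
  reverse_poly m (reverse_poly m p) = p.
Proof.
move=> pm; apply/polyP => i; rewrite !coef_poly; case: ltnP => im.
  by rewrite ltnS leq_subr subKn.
by rewrite nth_default// (leq_trans pm).
Qed.

Lemma horner_reverse_poly m (p : {poly R[i]}) (l : R[i]) : l != 0 -> (size p <= m.+1)%N ->
  (reverse_poly m p).[l] = l ^+ m * p.[l^-1].
Proof.
move=> l0 pm; rewrite (horner_coef_wide _ pm) horner_poly mulr_sumr.
rewrite (reindex_inj rev_ord_inj) /=; apply: eq_bigr => i _.
have im : (i <= m)%N by rewrite -ltnS.
rewrite subSS subKn// mulrCA exprVn; congr (_ * _).
by rewrite expfB_cond// (negPf l0).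
Qed.

End Sphere.

(** * Expansions at infinity *)

Section ComplexLimits.
Context {R : realType}.

Lemma cvg_normcP (u : nat -> R[i]) (l : R[i]) :
  u @ \oo --> l <->
  forall e : R, 0 < e -> exists N, forall n, (N <= n)%N -> normc (l - u n) < e.
Proof.
split=> [/cvgrPdist_lt h e e0|h].
  have [|N _ hN] := h e%:C; first by rewrite ltcR.
  by exists N => n /hN /=; rewrite ltcR.
apply/cvgrPdist_lt => -[e f]; rewrite ltcE /= => /andP[/eqP-> e0].
have [N hN] := h e e0; exists N => // n /hN /=.
by rewrite -[e +i* 0]/(e%:C) -[`|_|]/((normc _)%:C) ltcR.
Qed.

Lemma geometric_sum_le2 (k : R) n : 0 <= k <= 1 / 2 -> \sum_(j < n) k ^+ j <= 2.
Proof.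
move=> /andP[k0 k2]; suff : \sum_(j < n) k ^+ j <= 2 - 2 * k ^+ n.
  by move=> /le_trans; apply; rewrite lerBlDr lerDl mulr_ge0// exprn_ge0.
elim: n => [|n IH]; first by rewrite big_ord0 expr0; lra.
have := exprn_ge0 n k0; rewrite big_ord_recr /= exprS.
have : k * k ^+ n <= 1 / 2 * k ^+ n by rewrite ler_wpM2r// exprn_ge0.
lra.
Qed.

(** A convergent expansion at infinity is asymptotic: its terms are bounded at one
    point, hence dominated by a geometric progression twice as far out. *)
Lemma expansion_asymptotic (F : sphere R -> R[i]) (s : nat -> R[i]) J :
  expansion_at_infty F s -> exists K M : R, forall l : R[i], M < normc l ->
  normc (\sum_(j < J) s j * l ^- j.+1 + F (Some l)) <= K * normc l ^- J.+1.
Proof.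
move=> [M0 hs]; pose M1 := `|M0| + 1.
have M10 : 0 < M1 by rewrite ltr_wpDl.
have nM1 : normc M1%:C = M1 by rewrite normc_real gtr0_norm.
have [C C0 hC] : exists2 C : R, 0 <= C & forall j, normc (s j) <= C * M1 ^+ j.+1.
  have MM1 : M0%:C < `|M1%:C|.
    by rewrite -[`|_|]/((normc _)%:C) nM1 ltcR /M1 ltr_pwDr// ler_norm.
  have /cvg_normcP/(_ 1 ltr01)[N hN] := hs _ MM1.
  pose u j := s j * M1%:C ^- j.+1.
  have us j : normc (s j) = normc (u j) * M1 ^+ j.+1.
    by rewrite normcM normcV normcX nM1 divfK// expf_neq0// gt_eqF.
  exists (2 + \sum_(j < N) normc (u j)).
    by rewrite addr_ge0// sumr_ge0// => j _; exact: normc_ge0.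
  move=> j; rewrite us ler_wpM2r ?exprn_ge0 ?(ltW M10)//.
  have [jN|jN] := ltnP j N.
    rewrite (bigD1 (Ordinal jN))//= addrCA lerDl addr_ge0//.
    by apply: sumr_ge0 => i _; exact: normc_ge0.
  have h1 := hN _ jN; have h2 := hN _ (leqW jN).
  have e : u j = (- F (Some M1%:C) - series u j) - (- F (Some M1%:C) - series u j.+1).
    by rewrite /series/= big_nat_recr//=; ring.
  have h3 : normc (u j) <= 2.
    rewrite {1}e (le_trans (le_normcD _ _))// normcN.
    by move: h1 h2; rewrite -/u; lra.
  by rewrite (le_trans h3)// lerDl sumr_ge0// => i _; exact: normc_ge0.
exists (2 * C * M1 ^+ J.+1), (Num.max `|M0| (2 * M1)) => l.
rewrite gt_max => /andP[l0 l1].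
have nl : 0 < normc l by lra.
pose k := M1 / normc l.
have k01 : 0 <= k <= 1 / 2.
  by rewrite /k divr_ge0 ?(ltW M10) ?(ltW nl)//= ler_pdivrMr//; lra.
have Ml : M0%:C < `|l|.
  by rewrite -[`|_|]/((normc _)%:C) ltcR (le_lt_trans (ler_norm _)).
have /cvg_normcP hl := hs l Ml.
apply/ler_addgt0Pr => e e0; have [N hN] := hl e e0.
have := hN (J + N)%N (leq_addl _ _).
rewrite /series /= big_mkord big_split_ord /= => h.
set A := \sum_(j < J) _ in h *; set T := \sum_(i < N) _ in h.
have hT : normc T <= 2 * C * M1 ^+ J.+1 * normc l ^- J.+1.
  rewrite (le_trans (le_normc_sum _ _))//.
  rewrite (@le_trans _ _ (C * k ^+ J.+1 * \sum_(i < N) k ^+ i))//.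
    rewrite mulr_sumr; apply: ler_sum => i _.
    rewrite normcM normcV normcX (le_trans (ler_wpM2r _ (hC _)))//.
      by rewrite invr_ge0 exprn_ge0// ltW.
    rewrite /k -mulrA -exprD -mulrA -exprVn -exprMn.
    by rewrite addSn.
  have -> : 2 * C * M1 ^+ J.+1 * normc l ^- J.+1 = C * k ^+ J.+1 * 2.
    by rewrite /k exprMn exprVn; ring.
  rewrite ler_wpM2l ?geometric_sum_le2// mulr_ge0// exprn_ge0//.
  by have /andP[] := k01.
have -> : A + F (Some l) = - (- F (Some l) - (A + T)) - T by ring.
by rewrite (le_trans (le_normcD _ _))// !normcN addrC lerD// ltW.
Qed.

End ComplexLimits.

(** * The approximants as quadrature sums *)

Section PadeIdentification.
Context {R : realType} {E : set R}.
Context {sigma : {finite_measure set (measurableTypeR R) -> \bar R}}.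
Hypothesis compactE : compact E.
Hypothesis E1 : forall t, E t -> -1 <= t <= 1.

Let I : {poly R} -> R := @moment R E sigma.
Let F := Fsigma sigma E.

(** The node [0] is not a pole, since the kernel vanishes at [t = 0]. *)
Definition poles (xs : seq R) : seq R[i] := [seq x%:C | x <- xs & x != 0].

Definition quadrature_map (xs : seq R) (w : R -> R) (z : sphere R) : sphere R :=
  match z with
  | Some l => if l \in poles xs then None
              else Some (\sum_(x <- xs) (w x)%:C * cauchy_kernel l x)
  | None => Some 0
  end.

(** The quadrature sum is the reduced fraction [p / q]; as functions of [1 / l] its
    numerator and denominator are the reversed polynomials [A] and [B]. *)
Section Fraction.
Context {m : nat} {xs : seq R} {w : R -> R}.
Hypothesis quad : quadrature I (2 * m) xs w.
Hypothesis sxs : size xs = m.+1.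
Hypothesis xs0 : 0 \in xs.

Let ys : seq R := [seq x <- xs | x != 0].

Let uniq_ys : uniq ys. Proof. by rewrite filter_uniq//; case: quad. Qed.

Let size_ys : size ys = m.
Proof.
have [uxs _ _] := quad; rewrite /ys -[m]/(m.+1.-1) -sxs -(size_rem xs0).
by rewrite rem_filter.
Qed.

Let ys_neq0 y : y \in ys -> y != 0.
Proof. by rewrite mem_filter => /andP[]. Qed.

Let wpos y : y \in ys -> 0 < w y.
Proof. by rewrite mem_filter => /andP[_]; case: quad => _ h _ /h. Qed.

Let q : {poly R[i]} := \prod_(y <- ys) ('X - y%:C%:P).
Let co (y : R) : {poly R[i]} := \prod_(x <- ys | x != y) ('X - x%:C%:P).
Let p : {poly R[i]} := - \sum_(y <- ys) (w y * y)%:C *: co y.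

Let qE y : y \in ys -> q = ('X - y%:C%:P) * co y.
Proof. by move=> yys; rewrite /q (bigD1_seq y). Qed.

Let q_neq0 : q != 0.
Proof. by rewrite monic_neq0// monic_prod_XsubC. Qed.

Let size_q : size q = m.+1.
Proof. by rewrite size_prod_XsubC size_ys. Qed.

Let co_root x y : y \in ys -> x != y -> (co x).[y%:C] = 0.
Proof.
move=> yys xy; rewrite /co horner_prod; apply/eqP; rewrite prodf_seq_eq0.
by apply/hasP; exists y; rewrite // eq_sym xy hornerXsubC subrr eqxx.
Qed.

Let root_q l : (q.[l] == 0) = (l \in poles xs).
Proof.
rewrite -[_ == 0]/(root q l) /q -(big_map (real_complex R) xpredT (fun z => 'X - z%:P)).
by rewrite root_prod_XsubC.
Qed.

Let size_p : (size p < size q)%N.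
Proof.
rewrite size_q ltnS size_polyN (leq_trans (size_sum _ _ _))//.
apply/bigmax_leqP_seq => y yys _; rewrite (leq_trans (size_scale_leq _ _))//.
have := size_q; rewrite (qE yys) size_Mmonic ?polyXsubC_eq0//.
  by rewrite size_XsubC add2n => -[->].
by rewrite /co -big_filter monic_prod_XsubC.
Qed.

Let fractionE l : q.[l] != 0 ->
  p.[l] / q.[l] = \sum_(x <- xs) (w x)%:C * cauchy_kernel l x.
Proof.
move=> ql; rewrite (bigID (fun x => x != 0)) /= addrC big1 ?add0r; last first.
  by move=> x /negPn/eqP->; rewrite /cauchy_kernel rmorph0 mul0r mulr0.
rewrite -big_filter -/ys hornerN horner_sum mulNr mulr_suml -sumrN.
rewrite big_seq [RHS]big_seq; apply: eq_bigr => y yys.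
move: ql; rewrite (qE yys) hornerM hornerXsubC mulf_eq0 negb_or => /andP[h1 h2].
rewrite hornerZ rmorphM /cauchy_kernel /=; field.
by rewrite h1 h2 -opprB oppr_eq0 h1.
Qed.

Let coprime_pq : coprimep p q.
Proof.
apply/negPn/negP => /closed_rootP[z]; rewrite root_gcd => /andP[/eqP pz].
rewrite /root root_q => /mapP[y yys zy]; move/eqP: pz; apply/negP.
rewrite -/ys in yys; rewrite zy hornerN oppr_eq0 horner_sum (bigD1_seq y)//=.
rewrite big_seq_cond big1 => [|x /andP[xys xy]].
  rewrite addr0 hornerZ mulf_neq0//.
    by rewrite (inj_eq (@complexI _) _ 0) mulf_eq0 negb_or (gt_eqF (wpos yys)) ys_neq0.
  rewrite horner_prod prodf_seq_neq0; apply/allP => x _; apply/implyP => xy.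
  by rewrite hornerXsubC subr_eq0 (inj_eq (@complexI _)) eq_sym.
by rewrite hornerZ co_root ?mulr0.
Qed.

Let A : {poly R[i]} := reverse_poly m p.
Let B : {poly R[i]} := reverse_poly m q.

Let pm : (size p <= m.+1)%N. Proof. by rewrite -size_q ltnW. Qed.
Let qm : (size q <= m.+1)%N. Proof. by rewrite size_q. Qed.

Let AE l : l != 0 -> A.[l^-1] = l ^- m * p.[l].
Proof. by move=> l0; rewrite /A horner_reverse_poly ?invr_eq0// invrK exprVn. Qed.

Let BE l : l != 0 -> B.[l^-1] = l ^- m * q.[l].
Proof. by move=> l0; rewrite /B horner_reverse_poly ?invr_eq0// invrK exprVn. Qed.

Let ABE l : l != 0 -> A.[l^-1] / B.[l^-1] = p.[l] / q.[l].
Proof.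
by move=> l0; rewrite AE// BE// -mulf_div divff ?mul1r// invr_eq0 expf_neq0.
Qed.

Let bound : R := 1 + \sum_(x <- xs) `|x|.

Let bound1 : 1 <= bound.
Proof. by rewrite lerDl sumr_ge0. Qed.

Let le_bound x : x \in xs -> `|x| <= bound.
Proof.
have [uxs _ _] := quad; move=> xxs; rewrite /bound (bigD1_seq x)//= addrCA lerDl.
by rewrite addr_ge0// sumr_ge0.
Qed.

Let q_far l : bound < normc l -> q.[l] != 0.
Proof.
rewrite root_q => lb; apply/negP => /mapP[y yys ly]; move: lb; rewrite ly normc_real.
by move: yys; rewrite mem_filter ltNge => /andP[_ /le_bound ->].
Qed.

Let C : R := 2 * bound ^+ (2 * m).+1 * fine (sigma E).

Let quadrature_order l : 2 * bound < normc l ->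
  normc (p.[l] / q.[l] - F (Some l)) <= 3 * C * normc l ^- (2 * m).+1.
Proof.
move=> lb; have b0 : 0 < bound by exact: lt_le_trans bound1.
have lb1 : bound < normc l by lra.
rewrite fractionE ?q_far//.
apply: le_trans (quadrature_cauchy_far compactE E1 quad bound1 le_bound lb1) _.
have l0 : 0 < normc l by lra.
have s0 := @total_mass_ge0 _ E sigma.
rewrite -(mulrA 3) ler_pM2l//.
have -> : C * normc l ^- (2 * m).+1 =
    (bound / normc l) ^+ (2 * m) * (bound / (normc l / 2)) * fine (sigma E).
  by rewrite /C exprMn exprVn !exprS invf_div invfM; ring.
rewrite ler_wpM2r// ler_wpM2l ?exprn_ge0 ?divr_ge0 ?(ltW b0) ?(ltW l0)//.
rewrite ler_pM2l// lef_pV2 ?posrE; [lra|lra|lra].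
Qed.

Let moments (j : nat) : R[i] := (I 'X^(j.+1))%:C.

Let moments_expansion : expansion_at_infty F moments.
Proof.
exists 1 => l; rewrite -[`|_|]/((normc _)%:C) ltcR => l1.
apply/cvg_normcP => e e0.
have l0 : 0 < normc l by lra.
have k01 : 0 <= 1 / normc l < 1.
  by rewrite divr_ge0 ?(ltW l0)//= ltr_pdivrMr// mul1r.
have s0 := @total_mass_ge0 _ E sigma.
have C0 : 0 <= 2 * (1 / (normc l - 1) * fine (sigma E)).
  by apply: mulr_ge0 => //; apply: mulr_ge0 => //; rewrite divr_ge0// subr_ge0 ltW.
have [N hN] := geometric_small k01 C0 e0; exists N => n Nn.
rewrite -normcN opprB opprK addrC /series /= big_mkord.
rewrite (le_lt_trans (cauchy_moment_expansion compactE E1 n l1))//.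
rewrite (le_lt_trans _ hN)//.
rewrite [leRHS](_ : _ =
  2 * ((1 / normc l) ^+ N * (1 / (normc l - 1)) * fine (sigma E))); last by ring.
have /andP[k0 k1] := k01.
rewrite ler_pM2l// ler_wpM2r// ler_wpM2r ?divr_ge0 ?subr_ge0 ?(ltW l1)//.
by rewrite -(subnKC Nn) exprD ler_piMr ?exprn_ge0// exprn_ile1// ltW.
Qed.

Let pade_pair_quadrature : pade_pair F m A B.
Proof.
exists moments; split => //; try exact: size_reverse_poly.
  rewrite horner_coef0 /B /reverse_poly coef_poly /= subn0.
  have : lead_coef q = 1 by apply/monicP; rewrite /q monic_prod_XsubC.
  by rewrite lead_coefE size_q /= => ->; rewrite oner_eq0.
have [K [M hKM]] := expansion_asymptotic (2 * m) moments_expansion.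
exists (K + 3 * C), (Num.max M (2 * bound)) => l.
rewrite -![`|_|]/((normc _)%:C) ltcR gt_max => /andP[lM lb].
rewrite -rmorphXn -fmorphV -rmorphM lecR.
have l0 : l != 0.
  by rewrite -normc_gt0; have := bound1; lra.
rewrite ABE//.
have -> : \sum_(j < 2 * m) moments j * l ^- j.+1 + p.[l] / q.[l] =
  (\sum_(j < 2 * m) moments j * l ^- j.+1 + F (Some l)) + (p.[l] / q.[l] - F (Some l)).
  by ring.
rewrite (le_trans (le_normcD _ _))// mulrDl lerD ?hKM//.
exact: quadrature_order.
Qed.

(** Two fractions of degree [m] agreeing to order [2 m] at infinity are equal: the
    cross difference of numerators and denominators is a polynomial that tends
    to [0]. *)
Let pade_pair_unique A' B' : pade_pair F m A' B' ->
  reverse_poly m B' != 0 /\ reverse_poly m A' * q = p * reverse_poly m B'.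
Proof.
move=> [s [hs sA sB B0 [K1 [M1 h1]]]].
set p' := reverse_poly m A'; set q' := reverse_poly m B'.
have q'0 : q' != 0.
  apply: contraNneq B0 => q'0; rewrite horner_coef0.
  by rewrite -(reverse_polyK sB) -/q' q'0 coef_poly coef0.
split=> //; apply/eqP; rewrite -subr_eq0; apply/eqP.
have [K2 [M2 h2]] := expansion_asymptotic (2 * m) hs.
have [M3 [delta [d0 h3]]] := poly_lower_growth q'0.
have [C4 C40 h4] := poly_upper_growth (size_reverse_poly m B').
have [C5 C50 h5] := poly_upper_growth qm.
pose D := `|K1| + `|K2| + `|3 * C|.
apply: (@poly_vanishing_at_infty _ _ (C4 * C5 * D) (`|M1| + `|M2| + `|M3| + 2 * bound)) => l lbig.
have nM1 := ler_norm M1; have nM2 := ler_norm M2; have nM3 := ler_norm M3.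
have n1 := normr_ge0 M1; have n2 := normr_ge0 M2; have n3 := normr_ge0 M3.
have lb1 := bound1.
have l1 : 1 <= normc l by lra.
have nl0 : 0 < normc l by lra.
have l0 : l != 0 by rewrite -normc_gt0.
have ql : q.[l] != 0 by apply: q_far; lra.
have q'l : q'.[l] != 0.
  by rewrite -normc_gt0 (lt_le_trans d0)// h3//; lra.
have frac' : A'.[l^-1] / B'.[l^-1] = p'.[l] / q'.[l].
  rewrite /p' /q' !horner_reverse_poly// -mulf_div divff ?mul1r// expf_neq0//.
have -> : (p' * q - p * q').[l] = q.[l] * q'.[l] * (p'.[l] / q'.[l] - p.[l] / q.[l]).
  by rewrite hornerD hornerN !hornerM; field; rewrite ql q'l.
have dist : normc (p'.[l] / q'.[l] - p.[l] / q.[l]) <= D * normc l ^- (2 * m).+1.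
  rewrite -frac'.
  have -> : A'.[l^-1] / B'.[l^-1] - p.[l] / q.[l] =
    (\sum_(j < 2 * m) s j * l ^- j.+1 + A'.[l^-1] / B'.[l^-1])
    - (\sum_(j < 2 * m) s j * l ^- j.+1 + F (Some l))
    - (p.[l] / q.[l] - F (Some l)) by ring.
  have lp : 0 <= normc l ^- (2 * m).+1 by rewrite invr_ge0 exprn_ge0// ltW.
  rewrite (le_trans (le_normcD _ _))// normcN /D mulrDl lerD//; last first.
    rewrite (le_trans (quadrature_order _))//; first by lra.
    by rewrite ler_wpM2r// ler_norm.
  rewrite (le_trans (le_normcD _ _))// normcN mulrDl lerD//.
    have M1l : M1 < normc l by lra.
    rewrite (@le_trans _ _ (K1 * normc l ^- (2 * m).+1)) ?ler_wpM2r ?ler_norm//.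
    by have := h1 l; rewrite -![`|_|]/((normc _)%:C) ltcR -rmorphXn -fmorphV -rmorphM lecR; apply.
  rewrite (le_trans (h2 l _))//; first lra.
  by rewrite ler_wpM2r// ler_norm.
rewrite !normcM.
have g1 : normc q.[l] * normc q'.[l] <= C5 * normc l ^+ m * (C4 * normc l ^+ m).
  by rewrite ler_pM ?normc_ge0 ?h4 ?h5.
rewrite (le_trans (ler_pM _ (normc_ge0 _) g1 dist)) ?mulr_ge0 ?normc_ge0//.
rewrite le_eqVlt; apply/orP; left; apply/eqP.
rewrite exprS mul2n -addnn exprD; field.
by rewrite gt_eqF//= expf_neq0// gt_eqF.
Qed.

Theorem pade_quadrature : pade F m = quadrature_map xs w.
Proof.
have ratE A' B' : pade_pair F m A' B' ->
    ratfun (reverse_poly m A') (reverse_poly m B') = quadrature_map xs w.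
  move=> /pade_pair_unique[q'0 e]; rewrite (ratfunE coprime_pq q'0 q_neq0 e size_p).
  apply/funext => -[l|] //=; rewrite root_q; case: ifPn => // lq.
  by rewrite fractionE// root_q.
rewrite /pade; set S := [set _ | _].
have : S (quadrature_map xs w).
  by exists A, B; split; [exact: pade_pair_quadrature|rewrite ratE].
move=> /(xgetI (fun=> None)) [A' [B' [hAB ->]]]; exact: ratE.
Qed.

End Fraction.

End PadeIdentification.

(** * Neighbourhoods on the Riemann sphere *)

Section SphereNeighbourhoods.
Context {R : realType}.

Lemma nbhs_normcP (l : R[i]) (U : set R[i]) : nbhs l U <->
  exists2 r : R, 0 < r & forall z, normc (z - l) < r -> U z.
Proof.
split=> [/nbhs_ballP[[a b]]|[r r0 h]].
  rewrite /= ltcE /= => /andP[/eqP-> a0] h; exists a => // z zl; apply: h.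
  by rewrite -ball_normE /= -[`|_|]/((normc _)%:C) -[a +i* 0]/(a%:C) ltcR normcBC.
apply/nbhs_ballP; exists r%:C; first by rewrite /= ltcR.
move=> z; rewrite -ball_normE /= -[`|_|]/((normc _)%:C) ltcR normcBC; exact: h.
Qed.

Lemma normc_continuous : continuous (@normc R : R[i] -> R).
Proof.
move=> l U /nbhs_ballP[e e0 hU]; apply/nbhs_normcP; exists e => // z hz.
apply: hU; rewrite -ball_normE /=; apply: le_lt_trans hz.
rewrite ler_norml lerNl opprB [in X in _ && X]normcBC.
by rewrite !le_normcB.
Qed.

Lemma compact_normc_bounded (K : set R[i]) : compact K ->
  exists r : R, forall z, K z -> normc z <= r.
Proof.
move=> cK; have cn : {within K, continuous (@normc R : R[i] -> R)}.
  exact/continuous_subspaceT/normc_continuous.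
have /compact_bounded[M [Mr hM]] := continuous_compact cn cK.
exists (M + 1) => z Kz; rewrite (le_trans (ler_norm _))//.
by apply: (hM (M + 1)); [rewrite ltrDl|exists z].
Qed.

Lemma complex_pair_continuous :
  continuous (fun p : R * R => (p.1 +i* p.2 : R[i])).
Proof.
move=> [a b] U /nbhs_normcP[r r0 hU]; have r2 : 0 < r / 2 by rewrite divr_gt0.
exists (ball a (r / 2), ball b (r / 2)); first by split; exact: nbhsx_ballx.
move=> [a' b'] /= []; rewrite -!ball_normE /= => h1 h2; apply: hU.
rewrite (le_lt_trans (normc_ReIm _))//= [ltRHS]splitr.
by rewrite ltrD// distrC.
Qed.

Lemma closed_normc_le (r : R) : closed [set z : R[i] | normc z <= r].
Proof.
rewrite (_ : [set z | _] = @normc R @^-1` [set x | x <= r])//.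
by apply: closed_comp; [move=> z _; exact: normc_continuous|exact: closed_le].
Qed.

Lemma compact_normc_le (r : R) : compact [set z : R[i] | normc z <= r].
Proof.
have cS := @segment_compact R (- r) r.
have cI := continuous_compact (continuous_subspaceT complex_pair_continuous)
  (compact_setX cS cS).
apply: (subclosed_compact (closed_normc_le (r := r)) cI) => -[a b] /= ab.
exists (a, b) => //; split; rewrite /= in_itv /= -ler_norml.
  by rewrite (le_trans _ ab)// (normc_Re (a +i* b)).
by rewrite (le_trans _ ab)// (normc_Im (a +i* b)).
Qed.

(** These sets form a basis of neighbourhoods of infinity. *)
Definition sphere_exterior (r : R) : set (sphere R) :=
  [set z | if z is Some l then r < normc l else True].

Lemma nbhs_sphere_exterior (r : R) z : sphere_exterior r z ->
  nbhs (z : sphere R) (sphere_exterior r).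
Proof.
case: z => [l /= rl|_].
  apply/(@nbhs_normcP l); exists (normc l - r); rewrite ?subr_gt0// => z zl /=.
  have := le_normcB l (l - z); rewrite subKr normcBC; lra.
exists [set z : R[i] | normc z <= r].
  by split; [exact: compact_normc_le|exact: closed_normc_le].
by move=> z /= [[l /negP + <-]|->//]; rewrite -ltNge.
Qed.

Lemma nbhs_sphere_infty (U : set (sphere R)) : nbhs (None : sphere R) U ->
  exists r : R, sphere_exterior r `<=` U.
Proof.
move=> [K [cK _] KU]; have [r hr] := compact_normc_bounded cK.
exists r => -[l /= rl|_]; last by apply: KU; right.
by apply: KU; left; exists l => // /hr; rewrite leNgt rl.
Qed.

End SphereNeighbourhoods.

(** * Convergence of the approximants *)

Section PadeConvergence.
Context {R : realType} {alpha beta : R} {E : set R}.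
Context {sigma : {finite_measure set (measurableTypeR R) -> \bar R}}.
Context {P : nat -> {poly R}}.
Hypothesis alpha0 : alpha < 0.
Hypothesis beta0 : 0 < beta.
Hypothesis alpha1 : -1 < alpha.
Hypothesis EE : E = `[-1, alpha] `|` `[beta, 1].
Hypothesis sigmaE : sigma (~` E) = 0%E.
Hypothesis supp_infinite : infinite_set (msupport sigma).
Hypothesis orthP : monic_orthogonal sigma E P.

Let I : {poly R} -> R := @moment R E sigma.
Let F := Fsigma sigma E.
Let tau n := (P n).[0] / (P n.-1).[0].
Let cut (t : R) := t <= alpha \/ beta <= t.

Let compactE : compact E.
Proof. by rewrite EE; apply: compactU; exact: segment_compact. Qed.

Let E1 t : E t -> -1 <= t <= 1.
Proof.
have a0 := alpha0; have b0 := beta0.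
by rewrite EE => -[]; rewrite /= in_itv /= => /andP[h1 h2]; lra.
Qed.

Let Egap t : E t -> cut t.
Proof. by rewrite EE => -[]; rewrite /= in_itv /= => /andP[]; [left|right]. Qed.

Let orthI i j : i <> j -> I (P i * P j) = 0.
Proof.
by move=> /(orthP.2 i j) <-; apply: eq_Rintegral => t _; rewrite hornerM.
Qed.

Let rule n : Nset P n -> exists xs w,
  [/\ quadrature I (2 * n.-1) xs w, pade F n.-1 = quadrature_map xs w,
      @outside_gap R alpha beta xs,
      forall x, x \in xs -> `|x| <= 1 + `|tau n| &
      forall r : R, (forall x, x \in xs -> `|x| <= r) -> `|tau n| <= r + 1].
Proof.
case: n => [[]//|m [_ /= Pm]].
have [xs [w [quad [sxs xs0] gap bnd cnv]]] := gauss_quadrature alpha0 beta0 E1 Egap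
  (@moment_linear _ _ sigma compactE)
  (fun p => @moment_gt0 _ _ _ compactE p sigmaE supp_infinite)
  (fun j => (orthP.1 j).1) (fun j => (orthP.1 j).2)
  orthI Pm.
exists xs, w; split => //.
exact: pade_quadrature.
Qed.

Let quadrature_mapE xs w (z : R[i]) : (forall x, x \in xs -> x != 0 -> z != x%:C) ->
  quadrature_map xs w (Some z) =
  Some (F (Some z) + quadrature_error (E := E) (sigma := sigma) xs w (cauchy_kernel z)).
Proof.
move=> hz; rewrite /quadrature_map ifF.
  by congr Some; rewrite /quadrature_error addrC subrK.
apply/negP => /mapP[x]; rewrite mem_filter => /andP[x0 xxs] zx.
by have := hz x xxs x0; rewrite zx eqxx.
Qed.

Let F_infty : F None = 0. Proof. by []. Qed.

Let large_degree d n : (d < n)%N -> (d <= 2 * n.-1)%N.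
Proof. by case: n => // n; rewrite ltnS => /leq_trans; apply; rewrite leq_pmull. Qed.

Lemma pade_cvg_slit_plane (l : R[i]) : (forall t, cut t -> l != t%:C) ->
  exists2 U : set (sphere R), nbhs (Some l : sphere R) U & forall eps : R, 0 < eps ->
    \forall n \near \oo, Nset P n -> forall z, U z ->
      exists2 v : R[i], pade F n.-1 z = Some v & `|v - F z| < eps%:C.
Proof.
move=> lcut; have [r [r0 rcut hr]] :=
  @quadrature_cauchy_cvg _ _ _ _ sigma alpha0 beta0 alpha1 compactE E1 Egap l lcut.
exists (Some @` [set z | normc (z - l) < r]).
  by apply: one_point_compactification_some_nbhs; apply/nbhs_normcP; exists r.
move=> eps eps0; have [d0 hd0] := hr eps eps0.
exists d0.+1 => // n /= dn Nn _ [z zl <-].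
have [xs [w [quad padeE gap _ _]]] := rule Nn.
eexists; first rewrite padeE quadrature_mapE => [//|x xxs x0].
  by apply: rcut => //; case: (gap x xxs) => h; [left|rewrite h eqxx in x0|right].
rewrite addrC addKr -[`|_|]/((normc _)%:C) ltcR.
exact: (hd0 _ (large_degree dn)).
Qed.

Lemma pade_cvg_exterior (T r : R) : 0 <= T -> (forall n, Nset P n -> `|tau n| <= T) ->
  1 + T < r -> forall eps : R, 0 < eps ->
    \forall n \near \oo, Nset P n -> forall z, sphere_exterior r z ->
      exists2 v : R[i], pade F n.-1 z = Some v & `|v - F z| < eps%:C.
Proof.
move=> T0 tauT Tr eps eps0.
have B1 : 1 <= 1 + T by rewrite lerDl.
have [d0 hd0] := @quadrature_cauchy_cvg_infty _ _ sigma compactE E1 _ _ _ B1 Tr eps0.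
exists d0.+1 => // n /= dn Nn z zr.
have [xs [w [quad padeE _ bnd _]]] := rule Nn.
have {}bnd x : x \in xs -> `|x| <= 1 + T.
  by move=> /bnd/le_trans; apply; rewrite lerD2l tauT.
case: z zr => [l /= lr|_]; last first.
  by exists 0; rewrite ?padeE// F_infty subrr normr0 ltcR.
eexists; first rewrite padeE quadrature_mapE => [//|x xxs x0].
  apply/eqP => lx; have := bnd x xxs; move: lr; rewrite lx normc_real; lra.
rewrite addrC addKr -[`|_|]/((normc _)%:C) ltcR.
exact: (hd0 _ (large_degree dn) _ _ quad bnd l (ltW lr)).
Qed.

(** A pole of large modulus would contradict convergence near infinity, so the
    nodes are bounded for large [n]. *)
Lemma bounded_of_cvg_infty (eps : R) :
  cvg_loc_unif (Nset P) (fun n => pade F n.-1) F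
    (~` real_pts (`[-1 - eps, alpha] `|` `[beta, 1 + eps])) ->
  exists T : R, forall n, Nset P n -> `|tau n| <= T.
Proof.
have a0 := alpha0; have b0 := beta0.
move=> /(_ None)[|U /nbhs_sphere_infty[r rU] /(_ 1 ltr01)[N _ hN]]; first by case.
pose B := `|r| + `|1 + eps| + 1.
have hr := ler_norm r; have he := ler_norm (1 + eps).
have r0 := normr_ge0 r; have e0 := normr_ge0 (1 + eps).
pose S := \sum_(n < N) `|tau n|.
exists (B + 1 + S) => n Nn; have S0 : 0 <= S by exact: sumr_ge0.
have [nN|nN] := ltnP n N.
  have B1 : 0 <= B + 1 by rewrite /B; lra.
  by rewrite /S (bigD1 (Ordinal nN))//= addrCA lerDl; apply: addr_ge0 => //; exact: sumr_ge0.
have [xs [w [quad padeE gap _ cnv]]] := rule Nn.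
rewrite (@le_trans _ _ (B + 1)) ?lerDl//; apply: cnv => x xxs.
rewrite leNgt; apply/negP => Bx.
have x0 : x != 0 by rewrite -normr_gt0; rewrite /B in Bx; lra.
have xD : (~` real_pts (`[-1 - eps, alpha] `|` `[beta, 1 + eps]))
    (Some x%:C : sphere R).
  move=> [y hy [yx]]; rewrite yx in hy.
  suff : `|x| <= `|1 + eps| by rewrite /B in Bx; lra.
  rewrite (le_trans _ he)// ler_norml.
  by case: hy; rewrite /= in_itv /= => /andP[h1 h2]; lra.
have xU : U (Some x%:C : sphere R).
  have rx : r < normc x%:C by rewrite normc_real; rewrite /B in Bx; lra.
  exact: (rU (Some x%:C)).
have [v + _] := hN n nN Nn _ xD xU.
rewrite padeE /quadrature_map ifT//.
by apply/mapP; exists x => //; rewrite mem_filter x0.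
Qed.

End PadeConvergence.

Theorem theorem5p5 (R : realType) (alpha beta : R)
    (halpha1 : -1 < alpha) (halpha0 : alpha < 0)
    (hbeta0 : 0 < beta) (hbeta1 : beta < 1)
    (E : set R) (hE : E = `[-1, alpha] `|` `[beta, 1])
    (sigma : {finite_measure set (measurableTypeR R) -> \bar R})
    (hsigmaE : sigma (~` E) = 0%E)
    (hsupp : infinite_set (msupport sigma))
    (P : nat -> {poly R}) (hP : monic_orthogonal sigma E P) :
  cvg_loc_unif (Nset P) (fun n => pade (Fsigma sigma E) n.-1) (Fsigma sigma E)
    (range (Some : R[i] -> sphere R)
       `\` real_pts (`]-oo, alpha] `|` `[beta, +oo[))
  /\
  ((exists2 eps : R, 0 < eps &
      cvg_loc_unif (Nset P) (fun n => pade (Fsigma sigma E) n.-1)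
        (Fsigma sigma E)
        (~` real_pts (`[-1 - eps, alpha] `|` `[beta, 1 + eps])))
   <->
   (ereal_sup [set `|(P n).[0] / (P n.-1).[0]|%:E | n in Nset P] < +oo)%E).
Proof.
have slit := @pade_cvg_slit_plane _ _ _ _ _ _ halpha0 hbeta0 halpha1 hE
  hsigmaE hsupp hP.
split.
  move=> _ [[l _ <-] lcut]; have [|U Ul hU] := slit l.
    move=> t tcut; apply/eqP => lt; apply: lcut; exists t; rewrite ?lt//.
    by case: tcut => h; [left|right]; rewrite /= in_itv/= ?andbT.
  exists U => // eps /hU; apply: filterS => n hn Nn z _; exact: hn.
split=> [[eps eps0]|].
  move=> /(bounded_of_cvg_infty halpha0 hbeta0 hE hsigmaE hsupp hP)[T hT].
  rewrite (@le_lt_trans _ _ T%:E) ?ltry//; apply: ge_ereal_sup => _ [n Nn <-].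
  by rewrite lee_fin hT.
set S := ereal_sup _ => Soo; pose T := Num.max 0 (fine S).
have T0 : 0 <= T by rewrite le_max lexx.
have tauT n : Nset P n -> `|(P n).[0] / (P n.-1).[0]| <= T.
  move=> Nn; have h : (`|(P n).[0] / (P n.-1).[0]|%:E <= S)%E.
    by apply: ereal_sup_ubound; exists n.
  rewrite le_max; apply/orP; right; rewrite -lee_fin fineK//.
  by rewrite fin_numElt Soo andbT (lt_le_trans _ h)// ltNyr.
exists (T + 1); first by rewrite ltr_wpDl.
have ext := pade_cvg_exterior halpha0 hbeta0 hE hsigmaE hsupp hP T0 tauT.
have exterior z : sphere_exterior (T + 3 / 2) z ->
    exists2 U : set (sphere R), nbhs z U & forall eps : R, 0 < eps ->
    \forall n \near \oo, Nset P n -> forall w,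
      (~` real_pts (`[-1 - (T + 1), alpha] `|` `[beta, 1 + (T + 1)])) w -> U w ->
      exists2 v : R[i], pade (Fsigma sigma E) n.-1 w = Some v &
        `|v - Fsigma sigma E w| < eps%:C.
  move=> zr; exists (sphere_exterior (T + 3 / 2)); first exact: nbhs_sphere_exterior.
  have Tr : 1 + T < T + 3 / 2 by lra.
  move=> eps /(ext _ Tr); apply: filterS => n hn Nn w _; exact: hn.
case=> [l lD|_]; last exact: exterior.
have [lcut|/existsNP[t /not_implyP[tcut /negP/negPn/eqP lt]]] :=
    pselect (forall t, t <= alpha \/ beta <= t -> l != t%:C).
  have [U Ul hU] := slit l lcut.
  by exists U => // eps /hU; apply: filterS => n hn Nn z _; exact: hn.
apply: exterior; rewrite /= lt normc_real ltNge ler_norml; apply/negP => /andP[t1 t2].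
apply: lD; exists t; rewrite ?lt//.
by case: tcut => h; [left|right]; rewrite /= in_itv/=; lra.
Qed.
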